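(* Let $d\ge 2$, let $r,k\in\mathbb{N}$, let $\Omega$ be a probability space, and let $f\in L^2(\Omega^{S_r})$ be a real-valued function that is invariant under $\mathrm{Aut}(S_r)$ and is not almost everywhere constant. Let $G$ be a $d$-regular graph of girth at least $k+2r+2$. If $v,w$ are two vertices at distance $k$ in $G$, then the absolute value of the correlation of the values $h^f(v)$ and $h^f(w)$ produced by the randomized local algorithm with rule $f$ on $G$ is at most $$\Bigl(k+1-\frac{2k}{d}\Bigr)(d-1)^{-k/2}.$$
   Context: $T_d$ denotes the infinite $d$-regular tree, and $T_d^*$ is $T_d$ with a distinguished vertex $o$, called the root. $S_r$ denotes the ball of radius $r$ around the root in $T_d^*$, regarded as a rooted tree; $\mathrm{Aut}(S_r)$ is the group of its root-preserving automorphisms, acting on $\Omega^{S_r}$ (labelings of the vertices of $S_r$ by elements of $\Omega$, with the product probability measure) by permuting coordinates. Randomized local algorithm with rule $f$: given a $d$-regular graph $G$ with girth larger than $2r+1$, the ball of radius $r$ around every vertex $v$ of $G$, rooted at $v$, is isomorphic to $S_r$. Let $h:V(G)\to\Omega$ be a random labeling whose values are independent and each distributed according to the probability measure of $\Omega$. For $v\in V(G)$ let $h^f(v)$ be the value of $f$ on the labeled ball of radius $r$ around $v$, identified with an element of $\Omega^{S_r}$ through any rooted isomorphism of this ball with $S_r$ (the value does not depend on the choice since $f$ is $\mathrm{Aut}(S_r)$-invariant). The output of the algorithm is the random labeling $h^f$. The correlation of two real random variables with finite nonzero variances is their covariance divided by the product of their standard deviations. *)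

(* Defs.v *)
From HB Require Import structures.
From mathcomp Require Import all_boot all_order all_algebra perm.
From mathcomp Require Import all_classical all_reals all_analysis.

Set Implicit Arguments.
Unset Strict Implicit.
Unset Printing Implicit Defensive.

Import Order.TTheory GRing.Theory Num.Theory.
Import numFieldNormedType.Exports.

Local Open Scope classical_set_scope.
Local Open Scope card_scope.
Local Open Scope ring_scope.

(* A (possibly infinite) simple graph is a symmetric irreflexive [e : rel V]. *)
Section Graphs.
Context {V : choiceType}.
Implicit Types (e : rel V) (u v w : V).

Definition regular e d := forall v, [set u | e v u] #= `I_d.

Definition walk e v w n :=
  exists p : seq V, [/\ path e v p, last v p = w & size p = n].

Definition at_distance e v w k :=
  walk e v w k /\ forall n, walk e v w n -> (k <= n)%N.

Definition gball e v r : set V := [set w | exists2 n, (n <= r)%N & walk e v w n].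

(* Vacuously true for every [n] when the graph is a forest (infinite girth). *)
Definition girth_at_least e n :=
  forall c : seq V, ucycle e c -> (3 <= size c)%N -> (n <= size c)%N.

End Graphs.

(* The rooted tree T_d^* is the Cayley graph of the free product of d copies of
   Z/2: its vertices are the words over d letters without two equal consecutive
   letters, the root is the empty word, and two words are adjacent when one is
   obtained from the other by removing its first letter. *)
Section Tree.
Variable d : nat.

Definition reduced (w : seq 'I_d) := sorted [rel a b | a != b] w.

Definition word_edge : rel (seq 'I_d) := [rel u w |
  ((u != [::]) && (behead u == w)) || ((w != [::]) && (behead w == u))].

Definition tree := {w : seq 'I_d | reduced w}.

Definition tree_root : tree := exist (fun w => reduced w) [::] isT.

Definition tree_edge : rel tree := [rel x y : tree | word_edge (sval x) (sval y)].

Variable r : nat.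

(* The ball S_r: reduced words of length at most r. *)
Definition tball := {w : r.-bseq 'I_d | reduced w}.

Definition tball_root : tball := exist (fun w : r.-bseq 'I_d => reduced w) [bseq] isT.

Definition tball_edge : rel tball := [rel x y : tball | word_edge (sval x) (sval y)].

Definition tball_tree (x : tball) : tree :=
  exist (fun w => reduced w) (sval x) (svalP x).

Definition tball_aut (g : {perm tball}) :=
  g tball_root = tball_root /\
  forall x y, tball_edge (g x) (g y) = tball_edge x y.

End Tree.

Arguments tree_root {d}.
Arguments tball_root {d r}.

Definition rooted_iso (V : choiceType) (e : rel V) (v : V) d r
    (phi : tball d r -> V) :=
  [/\ injective phi, phi tball_root = v, range phi = gball e v r &
      forall x y, e (phi x) (phi y) = tball_edge x y].

(* The tree and its balls defined above are the intended ones: [tree d] is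
   d-regular, acyclic and connected (take the union over [r] in the last lemma),
   and [tball d r] is its ball of radius [r] around the root. *)
Section TreeTheory.
Variable d : nat.
Implicit Types x y : tree d.

Lemma tree_edge_sym : symmetric (@tree_edge d).
Proof. by move=> x y; rewrite /tree_edge /word_edge /= orbC. Qed.

Lemma tree_edge_irr : irreflexive (@tree_edge d).
Proof.
move=> [w rw]; rewrite /tree_edge /word_edge /= orbb; case: w rw => //= a w _.
by apply/eqP => /(congr1 size) /= /n_Sn.
Qed.

Lemma tree_edge_size x y : tree_edge x y ->
  size (val x) = (size (val y)).+1 \/ size (val y) = (size (val x)).+1.
Proof.
case: x y => [x rx] [y ry]; rewrite /tree_edge /word_edge /=.
by case/orP => /andP[]; [case: x rx => // a u _ _ /eqP /= ->; left
                        |case: y ry => // a u _ _ /eqP /= ->; right].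
Qed.

Lemma tree_regular : regular (@tree_edge d) d.
Proof.
pose nb (w : seq 'I_d) a := if ohead w == Some a then behead w else a :: w.
have rnb w a : reduced w -> reduced (nb w a).
  rewrite /nb; case: w => //= b w; rewrite /reduced.
  case: eqP => [_|ba]; first exact: path_sorted.
  by move=> /= ->; rewrite andbT; apply/eqP => ab; apply: ba; rewrite ab.
have injnb w : injective (nb w).
  move=> a b; rewrite /nb; case: eqP => [wa|_]; case: eqP => [wb|_].
  - by move=> _; move: wa; rewrite wb => -[].
  - by case: w {wa} => [|c u] /(congr1 size) /= // /eqP; rewrite ltn_eqF.
  - by case: w {wb} => [|c u] /(congr1 size) /= // /eqP; rewrite gtn_eqF.
  - by case.
move=> [w rw].
pose f a : tree d := exist (fun w => reduced w) (nb w a) (rnb w a rw).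
rewrite (_ : [set u | _] = f @` [set: 'I_d]).
  have injf : {in [set: 'I_d] &, injective f}.
    by move=> a b _ _ /(congr1 sval) /injnb.
  by rewrite (card_eql (inj_card_eq injf)) card_eq_sym; exact: card_II.
apply/seteqP; split=> [[u ru]|_ [a _ <-]]; rewrite /tree_edge /word_edge /=.
  case/orP => /andP[].
    case: w rw @f => // a w rw f _ /eqP /= wu.
    by exists a => //; apply: val_inj => /=; rewrite /nb /= eqxx.
  case: u ru => // a u ru _ /eqP /= uw; exists a => //; apply: val_inj => /=.
  rewrite /nb -uw; case: u ru {uw} => //= b u /andP[ab _].
  by case: eqP => // -[ba]; rewrite ba eqxx in ab.
rewrite /nb; case: (w) => [|b u] /=; first by rewrite ?eqxx.
by case: (Some b == Some a); rewrite /= eqxx ?orbT.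
Qed.

Lemma tree_acyclic n : girth_at_least (@tree_edge d) n.
Proof.
move=> c /andP[cyc unic] c3; exfalso.
have [x0 x0c] : exists x, x \in c by case: c c3 {cyc unic} => // x; exists x; rewrite mem_head.
have [x xc xmax] : exists2 x, x \in c & forall y, y \in c -> (size (val y) <= size (val x))%N.
  case: (@arg_maxnP 'I_(size c) (Ordinal (ltnW (ltnW c3))) xpredT
    (fun i => size (val (nth x0 c i)))) => // i _ imax.
  exists (nth x0 c i); first exact: mem_nth.
  move=> y yc; have yi : (index y c < size c)%N by rewrite index_mem.
  by have := imax (Ordinal yi) isT; rewrite /= nth_index.
have parent y : y \in c -> tree_edge x y -> val y = behead (val x).
  move=> yc exy; have := xmax _ yc; move: exy; rewrite /tree_edge /word_edge /=.
  case/orP => /andP[_ /eqP <- //].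
  by case: (val y) => //= a u; rewrite ltnn.
have [i s def_c] := rot_to xc.
have : uniq (x :: s) by rewrite -def_c rot_uniq.
have : cycle (@tree_edge d) (x :: s) by rewrite -def_c rot_cycle.
have : (2 < size (x :: s))%N by rewrite -def_c size_rot.
have sc y : y \in s -> y \in c.
  by move=> ys; rewrite -(mem_rot i) def_c inE ys orbT.
case: s sc {def_c} => [|a [|b s]] // sc _.
rewrite /= rcons_path => /and3P[xa _ /andP[_ zx]] /and3P[_ anb _].
have zs : last b s \in b :: s by exact: mem_last.
rewrite tree_edge_sym in zx.
have := parent _ (sc _ (mem_head _ _)) xa.
rewrite -(parent _ _ zx); last by apply: sc; rewrite inE zs orbT.
by move=> /val_inj az; rewrite az zs in anb.
Qed.

Lemma tball_rooted_iso r :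
  rooted_iso (@tree_edge d) tree_root (@tball_tree d r).
Proof.
split=> //.
- move=> [x rx] [y ry] /(congr1 (@sval _ _)) /= xy.
  by apply: val_inj; apply: val_inj.
- exact: val_inj.
apply/seteqP; split=> [_ [[[w /= wr] rw] _ <-]|x [n nr [p [pp lp pn]]]].
  exists (size w) => //; rewrite /tball_tree /=.
  rewrite (_ : exist _ _ _ = exist (fun w => reduced w) w rw); last exact: val_inj.
  elim: w {wr} rw => [|a w IHw] rw.
    by exists [::]; split => //; exact: val_inj.
  have rw' : reduced w by move: rw; exact: path_sorted.
  have [p [pp lp pn]] := IHw rw'.
  exists (rcons p (exist (fun w => reduced w) (a :: w) rw)).
  rewrite rcons_path last_rcons size_rcons pn lp pp /tree_edge /word_edge /=.
  by rewrite eqxx orbT.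
have le_size : (size (val x) <= n)%N.
  rewrite -pn -lp; elim/last_ind: p {lp pn} pp => [|p y IHp] //.
  rewrite rcons_path last_rcons size_rcons => /andP[/IHp sp].
  move=> /tree_edge_size [e|->]; last by rewrite ltnS.
  by rewrite e in sp; exact: leqW (ltnW sp).
case: x lp le_size => w rw /= _ wn.
exists (exist (fun w : r.-bseq 'I_d => reduced w) (Bseq (leq_trans wn nr)) rw) => //.
exact: val_inj.
Qed.

End TreeTheory.

(* [Om]-labelings of [S], with the product sigma-algebra. *)
Definition cylinders (S : finType) d (Om : measurableType d) : set (set (S -> Om)) :=
  [set X | exists s (A : set Om), measurable A /\ X = [set x | A (x s)]].

Definition labeling (S : finType) d (Om : measurableType d) :=
  g_sigma_algebraType (@cylinders S d Om).

Section ProductProbability.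
Context d (Om : measurableType d) (R : realType) (mu : probability Om R).
Definition tuple_cons n (x : Om * n.-tuple Om) : n.+1.-tuple Om :=
  [tuple of x.1 :: x.2].

Lemma measurable_tuple_cons n : measurable_fun setT (@tuple_cons n).
Proof. exact: measurable_cons. Qed.

HB.instance Definition _ n :=
  isMeasurableFun.Build _ _ _ _ (@tuple_cons n) (@measurable_tuple_cons n).

Fixpoint tuple_prob n : probability (n.-tuple Om) R :=
  match n with
  | 0 => \d_ [tuple]
  | n'.+1 => distribution (mu \x tuple_prob n')%E (@tuple_cons n')
  end.

Lemma tuple_prob_box n (A : 'I_n -> set Om) : (forall i, measurable (A i)) ->
  tuple_prob n [set t | forall i, A i (tnth t i)] = (\prod_(i < n) mu (A i))%E.
Proof.
elim: n A => [|n IHn] A mA /=.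
  by rewrite big_ord0 diracE mem_set // => -[].
transitivity ((mu \x tuple_prob n)%E
    (A ord0 `*` [set t | forall i, A (lift ord0 i) (tnth t i)])).
  congr (_ _); apply/seteqP; split => -[x t] /=.
    move=> At; split=> [|i]; first exact: (At ord0).
    by have := At (lift ord0 i); rewrite tnthS.
  by move=> [Ax At] i; case: (unliftP ord0 i) => [j ->|->//]; rewrite tnthS.
rewrite product_measure1E ?big_ord_recl //.
  by congr (_ * _)%E; exact: (IHn (fun i => A (lift ord0 i))).
rewrite (_ : [set t | _] = \bigcap_i [set t | A (lift ord0 i) (tnth t i)]); last first.
  by apply/seteqP; split => t At i; [move=> _; exact: At | exact: At].
apply: fin_bigcap_measurable => [|i _]; first exact: finite_finset.
rewrite -[X in measurable X]setTI.
exact: (measurable_tnth (i : 'I_n) measurableT (mA (lift ord0 i))).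
Qed.

Section FiniteFamily.
Variable S : finType.

Definition tuple_labeling (t : #|S|.-tuple Om) : labeling S Om :=
  fun s => tnth t (enum_rank s).

Lemma measurable_tuple_labeling : measurable_fun setT tuple_labeling.
Proof.
apply: (@measurability _ _ _ (labeling S Om) setT _ (@cylinders S d Om) erefl).
move=> _ [_ [s [A [mA ->]]] <-].
exact: (measurable_tnth (enum_rank s) measurableT mA).
Qed.

HB.instance Definition _ :=
  isMeasurableFun.Build _ _ _ _ tuple_labeling measurable_tuple_labeling.

(* The product probability on Om^S, obtained from iterated binary products;
   [product_prob_box] is its characteristic property. *)
Definition product_prob : probability (labeling S Om) R :=
  distribution (tuple_prob #|S|) tuple_labeling.

Lemma product_prob_box (A : S -> set Om) : (forall s, measurable (A s)) ->
  product_prob [set x | forall s, A s (x s)] = (\prod_(s : S) mu (A s))%E.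
Proof.
move=> mA.
transitivity (tuple_prob #|S|
    [set t | forall i : 'I_#|S|, A (enum_val i) (tnth t i)]).
  apply: (congr1 (tuple_prob #|S|)); apply/seteqP; split => t /= At i.
    by have := At (enum_val i); rewrite /tuple_labeling enum_valK.
  by have := At (enum_rank i); rewrite enum_rankK.
rewrite (tuple_prob_box (A := fun i : 'I_#|S| => A (enum_val i))) //.
rewrite [RHS](reindex (fun i : 'I_#|S| => enum_val i)) //.
by exists enum_rank => i _; rewrite (enum_valK, enum_rankK).
Qed.

End FiniteFamily.
End ProductProbability.

(* [h] is a family of independent random elements of law [mu]. *)
Definition iid_labeling d (Om : measurableType d) (R : realType)
    (mu : probability Om R) d' (W : measurableType d') (P : probability W R)
    (V : choiceType) (h : V -> {RV P >-> Om}) :=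
  (forall v (A : set Om), measurable A -> distribution P (h v) A = mu A) /\
  (forall (s : seq V) (A : V -> set Om), uniq s -> (forall v, measurable (A v)) ->
     P (\bigcap_(v in [set` s]) (h v @^-1` A v)) =
     (\prod_(v <- s) P (h v @^-1` A v))%E).

Section LocalAlgorithm.
Context (d r : nat) (V : choiceType) (e : rel V).

(* A rooted isomorphism of S_r with the ball of radius r around v, if any. *)
Definition ball_iso (v : V) : tball d r -> V :=
  xget (fun=> v : V) [set phi | rooted_iso e v phi].

Definition rule_invariant (Om T : Type) (f : (tball d r -> Om) -> T) :=
  forall g : {perm tball d r}, tball_aut g -> forall x, f (x \o g) = f x.

Definition local_output (W Om T : Type) (f : (tball d r -> Om) -> T)
  (h : V -> W -> Om) (v : V) : W -> T := fun w => f (fun x => h (ball_iso v x) w).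

Lemma local_outputE (W Om T : Type) (f : (tball d r -> Om) -> T)
    (h : V -> W -> Om) (v : V) (phi : tball d r -> V) :
  rule_invariant f -> rooted_iso e v phi ->
  local_output f h v = fun w => f (fun x => h (phi x) w).
Proof.
move=> finv iphi; have [ip rp bp ep] := iphi.
have [] : rooted_iso e v (ball_iso v).
  by apply: (@xgetPex _ _ [set phi | rooted_iso e v phi]); exists phi.
set psi := ball_iso v => ipsi rpsi bpsi epsi.
have /choice[g gE] : forall x, exists y, phi y = psi x.
  move=> x; have : range phi (psi x) by rewrite bp -bpsi; exists x.
  by move=> [y _ <-]; exists y.
have ig : injective g by move=> x y gxy; apply: ipsi; rewrite -!gE gxy.
have gaut : tball_aut (perm ig).
  split=> [|x y]; first by apply: ip; rewrite permE gE rpsi rp.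
  by rewrite !permE -ep !gE epsi.
apply/funext => w; rewrite /local_output -[RHS](finv _ gaut); congr f.
by apply/funext => x /=; rewrite permE gE.
Qed.

End LocalAlgorithm.

Arguments local_output {d r V} e {W Om T} f h v.

Definition correlation d (W : measurableType d) (R : realType)
    (P : probability W R) (X Y : W -> R) : R :=
  fine (covariance P X Y) /
    (Num.sqrt (fine 'V_P[X]) * Num.sqrt (fine 'V_P[Y])).

(* Main.v *)
(* The ball of radius [k + r] around [v] unfolds to the regular tree, whose
   reduced words form the Cayley graph of a free product of copies of Z/2; by the
   girth hypothesis the covariance of the outputs at [v] and [w] equals [c k], where
   [c n] is the covariance at distance [n] of the same rule run on a large ball of the
   tree.  The sequence [c] is a positive definite radial kernel on the tree and, by
   independence, it has finite support.

   Let [q = d - 1], let [A] be the adjacency operator acting on radial functions and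
   let [u t] be the value at the root of [T_t(A / (2 sqrt q)) c], where [T_t] is the
   Chebyshev polynomial.  Applying Cauchy-Schwarz to [X] and [T_t(A / (2 sqrt q)) X]
   and using [2 T_t ^ 2 = T_2t + 1] gives [u t ^ 2 <= u 0 (u (2 t) + u 0) / 2].  As [c]
   has finite support, [u] is bounded, so that iterating this inequality along
   [t, 2 t, 4 t, ...] forces [|u t| <= u 0 = c 0].  Finally [E t n], which is [q ^ (n / 2)]
   times the value of [T_t(A / (2 sqrt q)) c] at distance [n], solves the discrete wave
   equation with boundary values [u], and solving it expresses [q ^ (k / 2) c k] through
   [u] with total weight [k + 1 - 2 k / d]. *)

Require Import Defs.
From HB Require Import structures.
From mathcomp Require Import all_boot all_order all_algebra perm.
From mathcomp Require Import all_classical all_reals all_analysis measurable_realfun.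
From mathcomp Require Import ring lra zify.

Set Implicit Arguments.
Unset Strict Implicit.
Unset Printing Implicit Defensive.

Import Order.TTheory GRing.Theory Num.Theory.
Import numFieldNormedType.Exports.

Local Open Scope classical_set_scope.
Local Open Scope ring_scope.

(** * The wave equation on the half-line *)

Section WaveEquation.
Variables (R : realFieldType) (q : R) (E : int -> nat -> R).
Hypotheses (q1 : 1 <= q) (E_even : forall (t : int) n, E (- t) n = E t n).
Hypothesis E_bd : forall t : int, E (t + 1) 0%N + E (t - 1) 0%N = (1 + q^-1) * E t 1%N.
Hypothesis E_wave : forall (t : int) n, E t n.+2 = E (t + 1) n.+1 + E (t - 1) n.+1 - E t n.

(** The wave equation says that the difference [E t n.+1 - E (t - 1) n] is constant along the lines
    where [t + n] is constant. It is thus equal to its value at [n = 0], which the boundary relation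
    computes. *)
Lemma wave_step (t : int) n : E t n.+1 = E (t - 1) n +
  (q * E (t + n%:Z + 1) 0%N - E (t + n%:Z - 1) 0%N) / (q + 1).
Proof.
have q_gt0 : 0 < q by exact: lt_le_trans ltr01 q1.
have q0 := lt0r_neq0 q_gt0.
have q10 : q + 1 != 0 by rewrite gt_eqF // addr_gt0.
elim: n t => [|n IHn] t.
  rewrite addr0; have -> : E t 1%N = (1 + q^-1)^-1 * (E (t + 1) 0%N + E (t - 1) 0%N).
    by rewrite E_bd mulKf // gt_eqF // ltr_wpDr // invr_ge0 ltW.
  by field; rewrite q0 q10.
rewrite E_wave (IHn (t + 1)) addrK.
have -> : t + 1 + n%:Z + 1 = t + n.+1%:Z + 1 by lia.
have -> : t + 1 + n%:Z - 1 = t + n.+1%:Z - 1 by lia.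
lra.
Qed.

(** Two uses of [wave_step] joined by the reflection of [-1] to [1]. Where [E 0] vanishes, this
    forces [q * E (n + 2) 0 = E n 0], which is the source of the boundedness of the boundary
    values. *)
Lemma wave_origin_step n : E 0 n.+2 - E 0 n =
  2 * (q * E (n%:Z + 2) 0%N - E n%:Z 0%N) / (q + 1).
Proof.
rewrite wave_step sub0r E_even wave_step subrr.
have -> : 0 + n.+1%:Z + 1 = n%:Z + 2 :> int by lia.
have -> : 0 + n.+1%:Z - 1 = n%:Z :> int by lia.
ring.
Qed.

(* Up to the two extreme terms, [E t n] is an average over [j <= n] of the values
   [E (t + n - 2 j) 0], which makes the induction telescope. *)
Lemma wave_bound B : (forall t : int, `|E t 0%N| <= B) ->
  forall (t : int) n, `|E t n| <= (1 + n%:R * (q - 1) / (q + 1)) * B.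
Proof.
move=> EB t n.
have q10 : 0 < q + 1 by rewrite addr_gt0 // (lt_le_trans ltr01).
have q1n0 := lt0r_neq0 q10.
pose Q (t : int) n := E t n - (E (t + n%:Z) 0%N + E (t - n%:Z) 0%N) / (q + 1).
have c0 : 0 <= (q - 1) / (q + 1) by rewrite divr_ge0 ?subr_ge0 // ltW.
have QS s m : Q s m.+1 = Q (s - 1) m + (q - 1) / (q + 1) * E (s + m%:Z + 1) 0%N.
  rewrite /Q wave_step.
  have -> : s + m.+1%:Z = s + m%:Z + 1 :> int by lia.
  have -> : s - m.+1%:Z = s - 1 - m%:Z :> int by lia.
  have -> : s - 1 + m%:Z = s + m%:Z - 1 :> int by lia.
  by field.
have QB s m : `|Q s m| <= m.+1%:R * ((q - 1) / (q + 1)) * B.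
  elim: m s => [|m IHm] s.
    have -> : Q s 0%N = (q - 1) / (q + 1) * E s 0%N.
      by rewrite /Q addr0; field.
    by rewrite normrM ger0_norm // mul1r ler_wpM2l.
  rewrite QS; set c := (q - 1) / (q + 1) in c0 IHm *.
  rewrite (le_trans (ler_normD _ _)) // -[m.+2%:R]natr1 2!mulrDl mul1r.
  by rewrite lerD // normrM ger0_norm // ler_wpM2l.
have -> : E t n = Q t n + (E (t + n%:Z) 0%N + E (t - n%:Z) 0%N) / (q + 1).
  by rewrite /Q subrK.
rewrite (le_trans (ler_normD _ _)) //.
have -> : (1 + n%:R * (q - 1) / (q + 1)) * B =
    n.+1%:R * ((q - 1) / (q + 1)) * B + (B + B) / (q + 1).
  by rewrite -[n.+1%:R]natr1; field.
rewrite lerD // normrM [`|_^-1|]ger0_norm ?invr_ge0 ?(ltW q10) //.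
rewrite ler_pM2r ?invr_gt0 // (le_trans (ler_normD _ _)) //.
by rewrite lerD.
Qed.

End WaveEquation.

(** The ratio [x = u / u 0] satisfies [x (2 t) >= 2 (x t) ^ 2 - 1], so an absolute value above 1
    would grow without bound along [2 t, 4 t, 8 t, ...]. The case [u 0 = 0] is immediate. *)
Lemma norm_le_of_doubling (R : archiRealFieldType) (u : nat -> R) B : 0 <= u 0%N ->
  (forall t, u t ^+ 2 <= u 0%N * ((u t.*2 + u 0%N) / 2)) ->
  (forall t, `|u t| <= B) -> forall t, `|u t| <= u 0%N.
Proof.
move=> u0 ud uB t; have [u00|u0n0] := eqVneq (u 0%N) 0.
  have := ud t; rewrite u00 mul0r => h.
  have : u t ^+ 2 == 0 by rewrite eq_le h sqr_ge0.
  by rewrite sqrf_eq0 => /eqP ->; rewrite normr0.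
have {}u0 : 0 < u 0%N by rewrite lt_neqAle eq_sym u0n0.
set U := u 0%N in u0 u0n0 ud *.
rewrite leNgt; apply/negP => ut.
pose x := fun t => u t / U.
have xd s : 2 * x s ^+ 2 - 1 <= x s.*2.
  rewrite /x -(ler_pM2r (mulr_gt0 u0 u0)).
  have -> : (2 * (u s / U) ^+ 2 - 1) * (U * U) = 2 * u s ^+ 2 - U * U by field.
  have -> : u s.*2 / U * (U * U) = U * u s.*2 by field.
  have := ud s; lra.
(* Only [|x t|] is known to exceed 1. One doubling removes the sign, so the iteration starts at
   [2 t]. *)
have x1 : 1 < x t.*2.
  apply: lt_le_trans (xd t).
  have : 1 < `|x t| by rewrite normrM normfV (gtr0_norm u0) ltr_pdivlMr // mul1r.
  move=> h; have : 1 < `|x t| ^+ 2 by rewrite exprn_egt1.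
  by rewrite real_normK ?num_real //; lra.
(* Each doubling at least quadruples the excess over 1, but linear growth is enough for the
   archimedean contradiction. *)
have xj j : 1 + j.+1%:R * (x t.*2 - 1) <= x (2 ^ j * t.*2)%N.
  elim: j => [|j IHj]; first by rewrite mul1n; lra.
  rewrite expnS -mulnA mul2n; apply: le_trans (xd _).
  have : 0 < x t.*2 - 1 by lra.
  move: (x (2 ^ j * t.*2)%N) (x t.*2 - 1) IHj => y a IHj a0.
  have ja : 0 < j.+1%:R * a by rewrite mulr_gt0.
  have aj : a <= j.+1%:R * a by rewrite ler_peMl ?ler1n ?ltW.
  rewrite -[j.+2%:R]natr1 mulrDl mul1r.
  move: IHj ja aj; move: (j.+1%:R * a) => b yb b0 ab; have y0 : 0 <= y by lra.
  have : (1 + b) ^+ 2 <= y ^+ 2 by rewrite ler_sqr ?nnegrE //; lra.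
  have := sqr_ge0 b; lra.
have a0 : 0 < x t.*2 - 1 by lra.
have B0 : 0 <= B by apply: le_trans (normr_ge0 _) (uB 0%N).
have Ba : 0 <= B / U / (x t.*2 - 1) by rewrite !divr_ge0 // ltW.
have := archi_boundP Ba; set j := Num.bound _ => jB.
have := xj j; apply/negP; rewrite -ltNge.
have xB : x (2 ^ j * t.*2)%N <= B / U.
  by rewrite ler_pM2r ?invr_gt0 //; apply: le_trans (ler_norm _) (uB _).
apply: le_lt_trans xB _; rewrite ltr_pdivrMr // in jB.
have : j%:R * (x t.*2 - 1) <= j.+1%:R * (x t.*2 - 1).
  by rewrite ler_wpM2r ?ler_nat // ltW.
lra.
Qed.

(** * Reduced words *)

(* Words act on reduced words by left multiplication in the free product of [d]
   copies of Z/2, whose Cayley graph is the tree. *)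
Section Words.
Context {d : nat}.
Implicit Types (a b : 'I_d) (l w : seq 'I_d).

Definition step a w := if ohead w == Some a then behead w else a :: w.

Definition act l w := foldr step w l.

Lemma step_reduced a w : reduced w -> reduced (step a w).
Proof.
rewrite /step; case: w => //= b w; case: eqP => [_|ab]; first exact: path_sorted.
by rewrite /reduced /= => ->; rewrite andbT; apply/eqP => e; apply: ab; rewrite e.
Qed.

Lemma step_cons a w : reduced (a :: w) -> step a w = a :: w.
Proof.
case: w => //= b w /andP[ab _].
by rewrite /step /= (inj_eq Some_inj) eq_sym (negbTE ab).
Qed.

Lemma stepK a w : reduced w -> step a (step a w) = w.
Proof.
rewrite {2}/step; case: w => [|b w] rw /=; first by rewrite /step /= eqxx.
case: eqP rw => [[->]|_] rw; first by rewrite step_cons.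
by rewrite /step /= eqxx.
Qed.

Lemma step_inj w : injective (step ^~ w).
Proof.
move=> a b; rewrite /step; case: eqP => [wa|_]; case: eqP => [wb|_].
- by move: wa; rewrite wb => -[].
- by case: w {wa} => [|c u] /(congr1 size) /= // /eqP; rewrite ltn_eqF.
- by case: w {wb} => [|c u] /(congr1 size) /= // /eqP; rewrite gtn_eqF.
- by case.
Qed.

Lemma size_step a w : (size (step a w) <= (size w).+1)%N.
Proof. by rewrite /step; case: ifP => // _; rewrite size_behead; lia. Qed.

Lemma size_step_ge a w : (size w <= (size (step a w)).+1)%N.
Proof. by rewrite /step; case: ifP => // _; rewrite ?size_behead /=; lia. Qed.

Lemma act_cat l1 l2 w : act (l1 ++ l2) w = act l1 (act l2 w).
Proof. exact: foldr_cat. Qed.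

Lemma act_reduced l w : reduced w -> reduced (act l w).
Proof. by move=> rw; elim: l => //= a l; exact: step_reduced. Qed.

Lemma act_nil l : reduced l -> act l [::] = l.
Proof.
by elim: l => //= a l IHl ral; rewrite IHl ?step_cons //; exact: path_sorted ral.
Qed.

Lemma size_act l w : (size (act l w) <= size l + size w)%N.
Proof. by elim: l => //= a l IHl; have := size_step a (act l w); lia. Qed.

Lemma size_act_ge l w : (size w <= size l + size (act l w))%N.
Proof. by elim: l => //= a l IHl; have := size_step_ge a (act l w); lia. Qed.

Lemma act_step a l w : reduced w -> act (step a l) w = step a (act l w).
Proof.
move=> rw; rewrite {1}/step; case: l => [|b l] //=.
by case: eqP => //= -[->]; rewrite stepK // act_reduced.
Qed.

Lemma act_act l m w : reduced w -> act (act l m) w = act l (act m w).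
Proof. by move=> rw; elim: l => //= a l IHl; rewrite act_step // IHl. Qed.

Lemma act_revK l w : reduced w -> act (rev l) (act l w) = w.
Proof.
move=> rw; elim: l => //= a l IHl.
by rewrite rev_cons -cats1 act_cat /= stepK // act_reduced.
Qed.

Lemma act_rev_self w : reduced w -> act (rev w) w = [::].
Proof. by move=> rw; rewrite -[X in act _ X]act_nil // act_revK. Qed.

Lemma rev_reduced w : reduced (rev w) = reduced w.
Proof.
by rewrite /reduced rev_sorted; apply: eq_sorted => a b /=; rewrite eq_sym.
Qed.

(* The word taking [x] to [y]. *)
Definition word_div y x := act y (rev x).

Lemma word_div_reduced y x : reduced x -> reduced (word_div y x).
Proof. by move=> rx; rewrite act_reduced // rev_reduced. Qed.

Lemma act_word_div y x : reduced x -> reduced y -> act (word_div y x) x = y.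
Proof. by move=> rx ry; rewrite act_act // act_rev_self // act_nil. Qed.

(** The letters are involutions, so the inverse of a word is its reversal. In particular the length
    of [word_div] is symmetric, as befits a distance. *)
Lemma word_divC x y : reduced x -> reduced y -> word_div x y = rev (word_div y x).
Proof.
move=> rx ry; have rz := word_div_reduced y rx.
rewrite -[X in word_div X _](act_revK (word_div y x) rx) act_word_div //.
rewrite /word_div act_act ?rev_reduced // -{2}[y]revK act_rev_self ?rev_reduced //.
by rewrite act_nil // rev_reduced.
Qed.

Lemma size_word_divC x y : reduced x -> reduced y ->
  size (word_div x y) = size (word_div y x).
Proof. by move=> rx ry; rewrite word_divC // size_rev. Qed.

Lemma word_div_step a x y : reduced x -> word_div (step a y) x = step a (word_div y x).
Proof. by move=> rx; rewrite /word_div act_step // rev_reduced. Qed.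

Lemma word_div_nil x : reduced x -> word_div x [::] = x.
Proof. exact: act_nil. Qed.

Lemma word_edgeP x y : reduced x -> reduced y ->
  reflect (exists a, y = step a x) (word_edge x y).
Proof.
move=> rx ry; apply: (iffP orP) => [[/andP[xn /eqP xy]|/andP[yn /eqP yx]]|[a ->]].
- case: x xn rx xy => // a x _ _ /= xy; exists a.
  by rewrite /step /= eqxx.
- case: y yn ry yx => // a y _ ry /= yx; exists a.
  by rewrite -yx step_cons.
- rewrite /step; case: (ohead x =P Some a) => [xa|_]; [left|right]; last by rewrite /= eqxx.
  by case: x xa {rx} => //= b x _; rewrite eqxx.
Qed.

(** Exactly one neighbour of a nonempty word is closer to the root, namely the one reached by
    cancelling its first letter. *)
Lemma sum_step (V : nmodType) (F : nat -> V) w :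
  \sum_a F (size (step a w)) =
  if w is [::] then F 1%N *+ d else F (size w).-1 + F (size w).+1 *+ d.-1.
Proof.
case: w => [|b w].
  by rewrite (eq_bigr (fun=> F 1%N)) // sumr_const card_ord.
rewrite (bigD1 b) //=; congr (_ + _); first by rewrite /step /= eqxx.
rewrite (eq_bigr (fun=> F (size w).+2)) => [|a ab].
  by rewrite sumr_const cardC1 card_ord.
by rewrite /step /= (inj_eq Some_inj) eq_sym (negbTE ab).
Qed.

End Words.

(** * Covers by the tree *)

Section NonBacktracking.
Context {V : choiceType} (e : rel V).
Hypotheses (e_sym : symmetric e) (e_irr : irreflexive e).
Implicit Types (s : seq V).

Fixpoint nobt s :=
  if s is x :: s' then (if s' is _ :: z :: _ then x != z else true) && nobt s' else true.

Lemma nobt_cat s1 s2 : nobt (s1 ++ s2) -> nobt s2.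
Proof. by elim: s1 => //= x s1 IHs /andP[_]. Qed.

(** Dropping vertices from the front until the tail has no repetition, the last dropped vertex
    recurs in the tail and the segment in between is a simple cycle. Length 1 is excluded by
    irreflexivity and length 2 by the absence of backtracking. *)
Lemma nobt_cycle s : sorted e s -> nobt s -> ~~ uniq s ->
  exists c, [/\ ucycle e c, (3 <= size c)%N & (size c < size s)%N].
Proof.
elim: s => // x s IHs /= es /andP[nx ns]; rewrite negb_and negbK.
case us : (uniq s) => /=; last first.
  move=> _; have [||c [? ? ?]] := IHs _ ns; rewrite ?us //; first exact: path_sorted es.
  by exists c; split=> //; exact: ltnW.
rewrite orbF => xs; case: (splitPr xs) us es nx => p1 p2 us es nx {xs ns IHs}.
exists (x :: p1); move: us es nx; rewrite cat_uniq cat_path /= negb_or.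
case/and3P => up1 /andP[xp1 _] _ /and3P[ep1 lx _] nx; split.
- by rewrite /ucycle /= xp1 up1 rcons_path ep1 lx.
- case: p1 nx lx {up1 xp1 ep1} => [|y [|z p1]] //=; first by rewrite e_irr.
  by rewrite eqxx.
- by rewrite size_cat /=; lia.
Qed.

Lemma walk_sym v w n : walk e v w n -> walk e w v n.
Proof.
move=> [p [ep <- <-]]; exists (rev (belast v p)); split.
- by rewrite (eq_path (e' := fun z => e^~ z)) ?rev_path // => x y; exact: e_sym.
- by case: p {ep} => //= x p; rewrite rev_cons last_rcons.
- by rewrite size_rev size_belast.
Qed.

(** Deleting a backtrack shortens a walk by two steps, so a shortest walk has none. *)
Lemma nobt_or_shorter v p : path e v p ->
  nobt (v :: p) \/ exists2 n, (n < size p)%N & walk e v (last v p) n.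
Proof.
elim: p v => [|y p IHp] v /=; first by left.
case/andP => vy ep; have [np|[n np [p' [ep' lp' sp']]]] := IHp y ep; last first.
  by right; exists n.+1; rewrite ?ltnS //; exists (y :: p'); rewrite /= vy ep' lp' sp'.
case: p ep np IHp => [|z p] ep np _; first by left.
have [vz|vz] := eqVneq v z; last by left.
right; exists (size p); first by rewrite /=; lia.
by exists p; rewrite vz /=; case/andP: ep.
Qed.

(** The walk is listed from [w] back towards [v], because words grow at their front. The default in
    [head v q] covers [k = 0], where [q] is empty and [w = v]. *)
Lemma at_distance_walk v w k : at_distance e v w k ->
  exists q : seq V, [/\ size q = k, sorted e (rcons q v), nobt (rcons q v)
    & head v q = w].
Proof.
move=> [/walk_sym[p [ep lp sp]] dmin]; exists (belast w p).
rewrite -lp -lastI size_belast; split=> //.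
  have [//|[n np /walk_sym wn]] := nobt_or_shorter ep.
  by move: wn (dmin n); rewrite lp -sp leqNgt np => wn /(_ wn).
by case: p lp {ep sp}.
Qed.

End NonBacktracking.

(** * Covering maps are injective below the girth *)

Section Covers.
Context {d : nat} {V : choiceType} (e : rel V).
Implicit Types (l w x y : seq 'I_d).

(** This is a covering map of graphs with source the tree: a bijection between the neighbours of
    each vertex and those of its image. *)
Definition cover (Phi : seq 'I_d -> V) := forall w, reduced w ->
  injective (fun a => Phi (step a w)) /\
  range (fun a => Phi (step a w)) = [set u | e (Phi w) u].

Lemma cover_translate Phi z : reduced z -> cover Phi -> cover (fun w => Phi (act w z)).
Proof.
move=> rz cPhi w rw.
have -> : (fun a => Phi (act (step a w) z)) = (fun a => Phi (step a (act w z))).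
  by apply/funext => a; rewrite act_step.
by have [] := cPhi _ (act_reduced w rz).
Qed.

Hypotheses (e_sym : symmetric e) (e_irr : irreflexive e).
Variables (Phi : seq 'I_d -> V) (g : nat).
Hypotheses (cPhi : cover Phi) (e_girth : girth_at_least e g).

Lemma cover_edge a w : reduced w -> e (Phi w) (Phi (step a w)).
Proof.
by move=> /cPhi[_ /seteqP[sub _]]; apply: (sub (Phi (step a w))); exists a.
Qed.

Lemma cover_edge_lift u w : reduced w -> e (Phi w) u -> exists a, u = Phi (step a w).
Proof. by move=> /cPhi[_ /seteqP[_ sub]] /sub[a _ <-]; exists a. Qed.

(** The vertices visited while the letters of [l] act one after the other on [w], the last visited
    coming first. *)
Fixpoint trail l w := if l is _ :: l' then act l w :: trail l' w else [:: w].

Lemma size_trail l w : size (trail l w) = (size l).+1.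
Proof. by elim: l => //= a l ->. Qed.

Lemma trail_consE l w : exists s, trail l w = act l w :: s.
Proof. by case: l => [|a l]; [exists [::]|exists (trail l w)]. Qed.

Lemma trail_mem l w : w \in trail l w.
Proof. by elim: l => [|a l IHl]; rewrite inE ?eqxx // IHl orbT. Qed.

Lemma trail_sorted l w : reduced w -> sorted e (map Phi (trail l w)).
Proof.
move=> rw; elim: l => //= a l; have [s ->] := trail_consE l w.
by move=> /= ->; rewrite e_sym cover_edge // act_reduced.
Qed.

(** A backtrack in the image would mean that two distinct letters lead from one word to the same
    vertex, against local injectivity. *)
Lemma trail_nobt l w : reduced w -> reduced l -> nobt (map Phi (trail l w)).
Proof.
move=> rw; elim: l => //= a l IHl rl.
rewrite (IHl (path_sorted rl)) andbT.
case: l rl {IHl} => //= b l /andP[ab _]; have [s ->] := trail_consE l w.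
have rm := act_reduced l rw.
apply/eqP => /= E; have [inj _] := cPhi (step_reduced b rm).
have := inj a b; rewrite stepK // => /(_ E) /eqP.
exact/negP.
Qed.

(** A nonempty reduced [l] would give a closed walk without backtracking, hence a cycle of length at
    most [size l], which is below the girth. *)
Lemma cover_inj_reduced l w : reduced w -> reduced l -> (size l < g)%N ->
  Phi (act l w) = Phi w -> l = [::].
Proof.
move=> rw rl lg; case: l rl lg => // a l rl lg E; exfalso.
have [|c [cc c3 cs]] := nobt_cycle e_irr (trail_sorted (a :: l) rw) (trail_nobt rw rl).
  by rewrite /= E negb_and negbK map_f ?trail_mem.
by have := e_girth cc c3; move: cs lg; rewrite size_map size_trail /=; lia.
Qed.

Lemma cover_inj l w : reduced w -> (size l < g)%N ->
  Phi (act l w) = Phi w -> act l w = w.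
Proof.
move=> rw lg; have r0 : reduced [::] by [].
have -> : act l w = act (act l [::]) w by rewrite act_act.
move=> E; rewrite (cover_inj_reduced rw _ _ E) ?act_reduced //.
by apply: leq_ltn_trans lg; have := size_act l [::]; rewrite addn0.
Qed.

Lemma cover_inj_close x y : reduced x -> reduced y -> (size x + size y < g)%N ->
  Phi x = Phi y -> x = y.
Proof.
move=> rx ry xyg E; rewrite -(act_nil rx) -(act_rev_self ry) -act_cat.
apply: cover_inj; rewrite ?size_cat ?size_rev //.
by rewrite act_cat act_rev_self // act_nil.
Qed.

Lemma cover_rooted_iso r : (2 * r + 1 < g)%N ->
  rooted_iso e (Phi [::]) (fun x : tball d r => Phi (val (val x))).
Proof.
move=> rg; split=> // [[x rx] [y ry] /= E||[x rx] [y ry] /=].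
- apply: val_inj; apply: val_inj; apply: cover_inj_close => //=.
  by move: (size_bseq x) (size_bseq y) rg => /=; lia.
- apply/seteqP; split=> [_ [[[x /= xr] rx] _ <-]|u [n nr [p [ep <- pn]]]].
    exists (size x) => //; elim: x {xr} rx => [|a x IHx] rx; first by exists [::].
    have rx' : reduced x := path_sorted rx.
    have [p [ep lp sp]] := IHx rx'; exists (rcons p (Phi (a :: x))).
    rewrite rcons_path last_rcons size_rcons ep lp sp; split=> //=.
    by rewrite -(step_cons rx) cover_edge.
  have [x [rx xn xu]] : exists x, [/\ reduced x, (size x <= size p)%N & Phi x = last (Phi [::]) p].
    elim/last_ind: p ep {pn} => [|p y IHp]; first by exists [::].
    rewrite rcons_path last_rcons size_rcons => /andP[/IHp[x [rx xp <-]]].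
    move=> /(cover_edge_lift rx)[a ->]; exists (step a x); split=> //.
      exact: step_reduced.
    by apply: leq_trans (size_step a x) _; rewrite ltnS.
  have xr : (size x <= r)%N by rewrite (leq_trans xn) // pn.
  by exists (exist (fun w : r.-bseq 'I_d => reduced w) (Bseq xr) rx).
- apply/idP/(word_edgeP rx ry) => [|[a ->]]; last exact: cover_edge.
  move=> /(cover_edge_lift rx)[a E]; exists a.
  (* The words compared have lengths at most [r + 1] and [r]. This, rather than injectivity on the
     ball, is what requires [2 * r + 1 < g]. *)
  apply/esym; apply: cover_inj_close (esym E) => //; first exact: step_reduced.
  by move: (size_step a x) (size_bseq x) (size_bseq y) rg => /=; lia.
Qed.

End Covers.

(** * Construction of a covering map through a prescribed walk *)

Section CoverExistence.
Context {d : nat} {V : choiceType} (e : rel V).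
Hypotheses (e_sym : symmetric e) (e_reg : regular e d).

Lemma regular_enum u : exists f : 'I_d -> V, injective f /\ range f = [set v | e u v].
Proof.
have := e_reg u; rewrite card_eq_sym => /card_bijP[f [f' fK f'K]].
have Id (i : 'I_d) : val i \in `I_d by rewrite inE /= ltn_ord.
exists (fun i : 'I_d => val (f (SigSub (Id i)))); split.
  by move=> i j /val_inj/(can_inj fK)/(congr1 val) /= /val_inj.
apply/seteqP; split=> [_ [i _ <-]|v uv].
  by have := set_valP (f (SigSub (Id i))).
have vs : v \in [set v | e u v] by rewrite inE.
have id : (val (f' (SigSub vs)) < d)%N by have := set_valP (f' (SigSub vs)).
exists (Ordinal id) => //; have -> : SigSub (Id (Ordinal id)) = f' (SigSub vs).
  exact: val_inj.
by rewrite f'K.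
Qed.

(** The prescribed values are imposed one at a time, each by a transposition of letters. Those
    already imposed survive because the prescribed letters are distinct and so are the prescribed
    vertices. *)
Lemma regular_enum_at u (s : seq ('I_d * V)) :
  uniq (unzip1 s) -> uniq (unzip2 s) -> all (fun x => e u x.2) s ->
  exists f : 'I_d -> V, [/\ injective f, range f = [set v | e u v] &
    {in s, forall x, f x.1 = x.2}].
Proof.
elim: s => [|[a t] s IHs] /=; first by have [f []] := regular_enum u; exists f.
move=> /andP[as1 us1] /andP[ts2 us2] /andP[ut es].
have [f [finj frange fs]] := IHs us1 us2 es.
have [b fb] : exists b, f b = t.
  by have : range f t by [rewrite frange]; move=> [b _ <-]; exists b.
exists (f \o tperm a b); split=> [||[c v]].
- by apply: inj_comp finj _; exact: perm_inj.
- rewrite -frange; apply/seteqP; split=> [_ [c _ <-]|_ [c _ <-]] /=.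
    by exists (tperm a b c).
  by exists (tperm a b c); rewrite //= tpermK.
- rewrite inE => /orP[/eqP[-> ->]|cs] /=; first by rewrite tpermL.
  have ca : a != c by apply: contra as1 => /eqP ->; exact: (map_f fst cs).
  have cb : b != c.
    apply: contra ts2 => /eqP bc; rewrite -fb bc (fs _ cs); exact: (map_f snd cs).
  by rewrite tpermD // (fs _ cs).
Qed.

Lemma regular_enum_choice : exists F : V -> seq ('I_d * V) -> 'I_d -> V, forall u s,
  [/\ injective (F u s), range (F u s) = [set v | e u v] &
    uniq (unzip1 s) -> uniq (unzip2 s) -> all (fun x => e u x.2) s ->
    {in s, forall x, F u s x.1 = x.2}].
Proof.
suff /choice[F FP] : forall us : V * seq ('I_d * V), exists f : 'I_d -> V,
    [/\ injective f, range f = [set v | e us.1 v] &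
    uniq (unzip1 us.2) -> uniq (unzip2 us.2) -> all (fun x => e us.1 x.2) us.2 ->
    {in us.2, forall x, f x.1 = x.2}].
  by exists (fun u s => F (u, s)) => u s; exact: (FP (u, s)).
move=> [u s] /=; case: (boolP [&& uniq (unzip1 s), uniq (unzip2 s) & all (fun x => e u x.2) s]).
  by case/and3P => u1 u2 es; have [f [? ? ?]] := regular_enum_at u1 u2 es; exists f.
move=> /negP n; have [f [? ?]] := regular_enum u; exists f; split=> // u1 u2 es.
by exfalso; apply: n; rewrite u1 u2 es.
Qed.

(** If [w] is a proper suffix of [z], the only constraint is that the letter of [z] preceding [w]
    leads to the matching vertex of [q]. For other words the list is empty. *)
Fixpoint next_step (z : seq 'I_d) (q : seq V) (w : seq 'I_d) : seq ('I_d * V) :=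
  match z, q with
  | a :: z', t :: q' => if w == z' then [:: (a, t)] else next_step z' q' w
  | _, _ => [::]
  end.

Lemma next_step_cat z1 a z2 q1 t q2 : size z1 = size q1 ->
  next_step (z1 ++ a :: z2) (q1 ++ t :: q2) z2 = [:: (a, t)].
Proof.
elim: z1 q1 => [|b z1 IHz] [|s q1] //=; first by rewrite eqxx.
case=> sz; case: eqP => [E|_]; last exact: IHz.
by have := congr1 size E; rewrite size_cat /=; lia.
Qed.

Lemma next_stepP z q w : size z = size q -> next_step z q w = [::] \/
  exists z1 a q1 t q2, [/\ z = z1 ++ a :: w, q = q1 ++ t :: q2, size q2 = size w &
    next_step z q w = [:: (a, t)]].
Proof.
elim: z q => [|a z IHz] [|t q] //=; first by left.
case=> zq; case: eqP => [->|_]; first by right; exists [::], a, [::], t, q.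
have [->|[z1 [b [q1 [s [q2 [-> -> sw E]]]]]]] := IHz _ zq; first by left.
by right; exists (a :: z1), b, (t :: q1), s, q2.
Qed.

(* Vertices are defined along words together with the vertex of the parent word;
   around each vertex the enumeration of its neighbours is chosen so that the letter
   leading to the parent does so, and so that the words between [::] and [z] follow
   the given walk. *)
Lemma cover_exists (v : V) (z : seq 'I_d) (q : seq V) : reduced z ->
  size q = size z -> sorted e (rcons q v) -> nobt (rcons q v) ->
  exists Phi : seq 'I_d -> V, [/\ cover e Phi, Phi [::] = v & Phi z = head v q].
Proof.
move=> rz qz eq nq; have [F FP] := regular_enum_choice.
pose cs w (p : V) := (if w is b :: _ then [:: (b, p)] else [::]) ++ next_step z q w.
pose st := fix st (w : seq 'I_d) : V * V :=
  if w is a :: w' then (F (st w').1 (cs w' (st w').2) a, (st w').1) else (v, v).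
pose Phi w := (st w).1.
pose par w := (st w).2.
have edge_parent a w : e (Phi (a :: w)) (Phi w).
  have [_ /seteqP[sub _] _] := FP (Phi w) (cs w (par w)).
  by rewrite e_sym; apply: (sub (Phi (a :: w))); exists a.
pose valid w := [/\ uniq (unzip1 (cs w (par w))), uniq (unzip2 (cs w (par w))) &
    all (fun x => e (Phi w) x.2) (cs w (par w))].
(* On the suffixes of [z] two constraints meet, one for the parent and one for the next vertex.
   Their letters differ since [z] is reduced, and their vertices differ since the walk does not
   backtrack. *)
have aligned z1 a w q1 t q2 : z = z1 ++ a :: w -> q = q1 ++ t :: q2 ->
    size w = size q2 -> Phi w = head v q2 ->
    (w != [::] -> par w = head v (behead q2)) -> valid w.
  move=> zE qE wq2 Phiw parw; have zq1 : size z1 = size q1.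
    by move: qz; rewrite zE qE !size_cat /= wq2 => /addIn.
  have raw : reduced (a :: w) by move: rz; rewrite zE => /cat_sorted2[].
  have eq2 : sorted e (t :: rcons q2 v).
    by move: eq; rewrite qE rcons_cat => /cat_sorted2[].
  have nq2 : nobt (t :: rcons q2 v) by move: nq; rewrite qE rcons_cat => /nobt_cat.
  have et : e (Phi w) t.
    by rewrite e_sym Phiw; case: (q2) eq2 => [|s q3] /= /andP[].
  rewrite /valid /cs zE qE next_step_cat //.
  case: w wq2 raw parw {Phiw zE} et => [|b w] /=; first by move=> _ _ _ ->.
  have := edge_parent b w; rewrite -/(par (b :: w)).
  case: q2 eq2 nq2 {qE} => //= s q3 _ nq2 ep _ /andP[ab _] /(_ isT) parw et.
  rewrite et ep parw !inE eq_sym ab /=; split=> //.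
  by move: nq2; case: (q3) => [|s' q4] /= /andP[]; rewrite eq_sym => ->.
have good z2 q2 z1 q1 : z = z1 ++ z2 -> q = q1 ++ q2 -> size z2 = size q2 ->
    Phi z2 = head v q2 /\ (z2 != [::] -> par z2 = head v (behead q2)).
  elim: z2 q2 z1 q1 => [|a z2 IHz] [|t q2] // z1 q1 zE qE [zq].
  have [] := IHz q2 (rcons z1 a) (rcons q1 t); rewrite ?cat_rcons // => Phiz parz.
  split=> // /=; have [u1 u2 es] := aligned _ _ _ _ _ _ zE qE zq Phiz parz.
  have [_ _ /(_ u1 u2 es)] := FP (Phi z2) (cs z2 (par z2)).
  move=> /(_ (a, t)); apply; rewrite /cs zE qE next_step_cat ?mem_cat ?inE ?eqxx ?orbT //.
  by move: qz; rewrite zE qE !size_cat /= zq => /addIn.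
have all_valid w : valid w.
  have [E|[z1 [a [q1 [t [q2 [zE qE wq2 _]]]]]]] := next_stepP w (esym qz).
    rewrite /valid /cs E cats0; case: w {E} => //= a w.
    by split=> //; rewrite andbT; exact: edge_parent.
  have [] := good w q2 (rcons z1 a) (rcons q1 t); rewrite ?cat_rcons //.
  by move=> Phiw parw; exact: aligned zE qE (esym wq2) Phiw parw.
exists Phi; split=> //; last by have [] := good z q [::] [::] erefl erefl (esym qz).
move=> w rw; have [u1 u2 es] := all_valid w.
have [inj rng vals] := FP (Phi w) (cs w (par w)).
(* When [a] cancels the first letter of [w], the equality is the parent constraint; otherwise it is
   the definition of [Phi]. *)
suff E a : Phi (step a w) = F (Phi w) (cs w (par w)) a.
  by rewrite (_ : (fun a => _) = F (Phi w) (cs w (par w))) //; apply/funext.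
rewrite /step; case: eqP => // wa; case: w wa {rw inj rng} u1 u2 es vals => //= b w [->] u1 u2 es.
by move=> /(_ u1 u2 es (a, Phi w)) /= -> //; rewrite inE eqxx.
Qed.

End CoverExistence.

(** * Positive definite radial kernels *)

Section Chebyshev.
Variables (R : realType) (d : nat).
Hypothesis hd : (2 <= d)%N.
Let q : R := d.-1%:R.
Let s : R := Num.sqrt q.

(* [T_t(A / (2 sqrt (d - 1))) x] for the Chebyshev polynomial [T_t]. *)
Fixpoint chebyshev (M : lmodType R) (A : M -> M) (x : M) t : M :=
  match t with
  | 0 => x
  | t'.+1 => match t' with
    | 0 => (2 * s)^-1 *: A x
    | t''.+1 => s^-1 *: A (chebyshev A x t') - chebyshev A x t''
    end
  end.

Definition neighbor_sum (L : lmodType R) (Y : seq 'I_d -> L) : seq 'I_d -> L :=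
  fun w => \sum_a Y (step a w).

Definition radial_adjacency (c : nat -> R^o) : nat -> R^o :=
  fun n => if n is n'.+1 then c n' + c n.+1 *+ d.-1 else c 1%N *+ d.

Definition radial_chebyshev (c : nat -> R) : nat -> nat -> R :=
  chebyshev radial_adjacency c.

Lemma sum_step_radial (c : nat -> R) (w : seq 'I_d) :
  \sum_a c (size (step a w)) = radial_adjacency c (size w).
Proof. by rewrite sum_step; case: w. Qed.

Section Kernel.
Variables (L : lmodType R) (B : L -> L -> R).
Hypotheses (BZl : forall a u v, B (a *: u) v = a * B u v)
  (BDl : forall u v w, B (u + v) w = B u w + B v w)
  (BC : forall u v, B u v = B v u) (B_ge0 : forall u, 0 <= B u u).

Lemma form_CauchySchwarz u v : B u v ^+ 2 <= B u u * B v v.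
Proof.
have BB a b : B (a *: u + b *: v) (a *: u + b *: v) =
    a ^+ 2 * B u u + 2 * a * b * B u v + b ^+ 2 * B v v.
  rewrite !(BDl, BZl) ![B _ (_ + _)]BC !(BDl, BZl) (BC v u); ring.
have := B_ge0 (B v v *: u + - B u v *: v); rewrite BB => h.
have := B_ge0 v; rewrite le_eqVlt => /orP[/eqP v0|v0].
  have [uv0|uv0] := eqVneq (B u v) 0; first by rewrite uv0 -v0 expr0n mulr0.
  (* The coefficient is chosen so that, [B v v] being zero, the form takes the value [-1] on this
     vector. *)
  have := B_ge0 (1 *: u + (- (B u u + 1) / (2 * B u v)) *: v); rewrite BB -v0.
  have -> : 2 * 1 * (- (B u u + 1) / (2 * B u v)) * B u v = - (B u u + 1) by field.
  lra.
rewrite -subr_ge0 -(pmulr_rge0 _ v0); apply: le_trans h _.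
by rewrite le_eqVlt; apply/orP; left; apply/eqP; ring.
Qed.

Let BNl u v : B (- u) v = - B u v.
Proof. by rewrite -scaleN1r BZl mulN1r. Qed.

Let B0l v : B 0 v = 0.
Proof. by rewrite -(scale0r 0) BZl mul0r. Qed.

Let B_suml (I : finType) (F : I -> L) v : B (\sum_i F i) v = \sum_i B (F i) v.
Proof. exact: (big_morph (B ^~ v) (fun u w => BDl u w v) (B0l v)). Qed.

Variables (N : nat) (X : seq 'I_d -> L) (c : nat -> R).
Hypothesis BX : forall x y, reduced x -> reduced y -> (size x <= N)%N ->
  (size y <= N)%N -> B (X x) (X y) = c (size (word_div y x)).

Let e := radial_chebyshev c.
Let V t := chebyshev (@neighbor_sum L) X t.

Let VSS t y : V t.+2 y = s^-1 *: (\sum_a V t.+1 (step a y)) - V t y.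
Proof. by []. Qed.

Let eSS t n : e t.+2 n = s^-1 * radial_adjacency (e t.+1) n - e t n.
Proof. by []. Qed.

(** Since [word_div] commutes with left multiplication of [y], summing over the neighbours of [y]
    acts on the kernel as the radial adjacency operator. Each degree reaches one level further,
    whence [size y + t <= N]. *)
Lemma kernel_chebyshev t x y : reduced x -> reduced y -> (size x <= N)%N ->
  (size y + t <= N)%N -> B (V t y) (X x) = e t (size (word_div y x)).
Proof.
move=> rx; elim/ltn_ind: t y => -[|[|t]] IH y ry xN yN.
- by rewrite BC BX // -[size y]addn0.
- rewrite BZl B_suml (eq_bigr (fun a => c (size (step a (word_div y x))))).
    by rewrite sum_step_radial.
  move=> a _; rewrite BC BX ?step_reduced // ?word_div_step //.
  by have := size_step a y; lia.
- rewrite VSS BDl BNl BZl B_suml eSS.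
  rewrite (eq_bigr (fun a => e t.+1 (size (step a (word_div y x))))) => [|a _].
    by rewrite sum_step_radial IH //; lia.
  rewrite IH ?step_reduced ?word_div_step //.
  by have := size_step a y; lia.
Qed.

(** This is the product formula [2 T_u T_t = T_(u + t) + T_(u - t)], by induction on [t]. *)
Lemma kernel_chebyshev2 t u x y : reduced x -> reduced y -> (size x + u <= N)%N ->
  (size y + t <= N)%N -> (t <= u)%N ->
  B (V t y) (V u x) =
    (e (u + t) (size (word_div y x)) + e (u - t) (size (word_div y x))) / 2.
Proof.
move=> rx; elim/ltn_ind: t y => -[|[|t]] IH y ry xN yN tu.
- rewrite BC kernel_chebyshev //; last by lia.
  by rewrite size_word_divC // addn0 subn0 -mulr2n -[_ *+ 2]mulr_natr mulfK.
- case: u xN tu IH => // u xN tu _.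
  rewrite BZl B_suml (eq_bigr (fun a => e u.+1 (size (step a (word_div y x))))) => [|a _].
    by rewrite sum_step_radial addn1 subn1 eSS /= subrK invfM -mulrA mulrC.
  rewrite BC kernel_chebyshev ?step_reduced //.
    by rewrite (size_word_divC rx) ?step_reduced // word_div_step.
  by have := size_step a y; lia.
- rewrite VSS BDl BNl BZl B_suml.
  rewrite (eq_bigr (fun a => e (u + t.+1) (size (step a (word_div y x))) / 2 +
      e (u - t.+1) (size (step a (word_div y x))) / 2)) => [|a _]; last first.
    rewrite IH ?step_reduced ?word_div_step // -?mulrDl //; last by lia.
    by have := size_step a y; lia.
  rewrite big_split /= -!mulr_suml !sum_step_radial IH //; try lia.
  rewrite !addnS [e (u + t).+2 _]eSS.
  have -> : (u - t = (u - t.+2).+2)%N by lia.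
  have -> : (u - t.+1 = (u - t.+2).+1)%N by lia.
  rewrite [e _.+2 _]eSS.
  move: (radial_adjacency _ _) (radial_adjacency _ _) (e _ _) (e _ _) => x1 x2 x3 x4.
  ring.
Qed.

Lemma radial_chebyshev_doubling t : (t <= N)%N ->
  e t 0%N ^+ 2 <= e 0%N 0%N * ((e t.*2 0%N + e 0%N 0%N) / 2).
Proof.
move=> tN; have := form_CauchySchwarz (V t [::]) (X [::]).
rewrite kernel_chebyshev // kernel_chebyshev2 // BX //= subnn addnn.
by rewrite mulrC.
Qed.

End Kernel.

Let q1 : 1 <= q.
Proof. by rewrite ler1n; lia. Qed.

Let q_gt0 : 0 < q.
Proof. exact: lt_le_trans ltr01 q1. Qed.

Let s_gt0 : 0 < s.
Proof. by rewrite sqrtr_gt0. Qed.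

Let s2 : s ^+ 2 = q.
Proof. by rewrite sqr_sqrtr // ltW. Qed.

(** The three-term recurrence extends to all integers through [T_(- t) = T_t]. At [t = 0] it holds
    because of the factor 2 in the degree-one coefficient. *)
Lemma radial_chebyshevZ (c : nat -> R) (t : int) n :
  radial_chebyshev c `|(t + 1)%R|%N n + radial_chebyshev c `|(t - 1)%R|%N n =
  s^-1 * radial_adjacency (radial_chebyshev c `|t|%N) n.
Proof.
have SS k m : radial_chebyshev c k.+2 m + radial_chebyshev c k m =
  s^-1 * radial_adjacency (radial_chebyshev c k.+1) m by rewrite /= subrK.
have s0 := lt0r_neq0 s_gt0.
case: t => [[|t]|[|t]].
- have e1 : radial_chebyshev c 1%N n = (2 * s)^-1 * radial_adjacency c n by [].
  by rewrite e1; field.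
- have -> : `|(t.+1%:Z + 1)%R|%N = t.+2 by lia.
  have -> : `|(t.+1%:Z - 1)%R|%N = t by lia.
  exact: SS.
- by rewrite addrC; exact: (SS 0%N).
- have -> : `|(Negz t.+1 + 1)%R|%N = t.+1 by lia.
  have -> : `|(Negz t.+1 - 1)%R|%N = t.+3 by lia.
  by rewrite addrC; exact: SS.
Qed.

Lemma radial_chebyshev_bound (c : nat -> R) m :
  (forall n, (m < n)%N -> c n = 0) -> 0 <= c 0%N ->
  (forall t, radial_chebyshev c t 0%N ^+ 2 <=
    c 0%N * ((radial_chebyshev c t.*2 0%N + c 0%N) / 2)) ->
  forall k, `|c k| <= (1 + k%:R * (q - 1) / (q + 1)) * s ^- k * c 0%N.
Proof.
move=> c_supp c_ge0 cd k; have s0 := lt0r_neq0 s_gt0.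
have q0 := lt0r_neq0 q_gt0; have q10 : q + 1 != 0 by rewrite gt_eqF // addr_gt0.
have [rc [rc0 rcZ cd']] : exists rc : nat -> nat -> R, [/\ rc 0%N = c,
    forall (t : int) n, rc `|(t + 1)%R|%N n + rc `|(t - 1)%R|%N n =
      s^-1 * radial_adjacency (rc `|t|%N) n &
    forall t, rc t 0%N ^+ 2 <= rc 0%N 0%N * ((rc t.*2 0%N + rc 0%N 0%N) / 2)].
  by exists (radial_chebyshev c); split=> //; exact: radial_chebyshevZ.
pose E (t : int) n := s ^+ n * rc `|t|%N n.
have E_even (t : int) n : E (- t) n = E t n by rewrite /E abszN.
have E_bd (t : int) : E (t + 1) 0%N + E (t - 1) 0%N = (1 + q^-1) * E t 1%N.
  rewrite /E !expr0 !mul1r rcZ /= -[X in _ *+ X]prednK; last by lia.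
  by rewrite mulrS -[_ *+ d.-1]mulr_natr -/q -s2; field.
have E_wave (t : int) n : E t n.+2 = E (t + 1) n.+1 + E (t - 1) n.+1 - E t n.
  rewrite /E -mulrDr rcZ /= -[_ *+ d.-1]mulr_natr -/q -s2 !exprS.
  by field.
have step := wave_origin_step q1 E_even E_bd E_wave.
have E0 n : E 0 n = s ^+ n * c n by rewrite /E rc0.
have Eu (t : int) : E t 0%N = rc `|t|%N 0%N by rewrite /E mul1r.
(* Beyond the support of [c] the origin identity reads [q * rc (n + 2) 0 = rc n 0], and [q >= 1]. *)
have rcS n : (m < n)%N -> `|rc n.+2 0%N| <= `|rc n 0%N|.
  move=> mn; have := step n; rewrite [E 0 n]E0 [E 0 n.+2]E0 !c_supp //; last by lia.
  rewrite !mulr0 subrr => /esym/eqP.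
  rewrite mulf_eq0 invr_eq0 (negbTE q10) orbF mulf_eq0 pnatr_eq0 /= subr_eq0 !Eu.
  have -> : `|(n%:Z + 2)%R|%N = n.+2 by lia.
  by move/eqP <-; rewrite normrM ler_peMl // ger0_norm // ltW.
(* From [t = m + 3] on, the index [t - 2] exceeds [m], so the first [m + 3] values control all the
   others. *)
have rc_bd t : `|rc t 0%N| <= \sum_(i < m.+3) `|rc i 0%N|.
  elim/ltn_ind: t => t IHt; case: (ltnP t m.+3) => tm.
    by rewrite (bigD1 (Ordinal tm)) //= lerDl sumr_ge0.
  have := IHt t.-2; case: t tm {IHt} => [|[|t]] // tm /(_ (ltnW (ltnSn _))).
  by apply: le_trans; apply: rcS.
have rc0_ge0 : 0 <= rc 0%N 0%N by rewrite rc0.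
have rc_le := norm_le_of_doubling (u := fun t => rc t 0%N) rc0_ge0 cd' rc_bd.
have E_le (t : int) : `|E t 0%N| <= c 0%N by rewrite Eu -rc0.
have := wave_bound q1 E_bd E_wave E_le 0 k.
rewrite E0 normrM (ger0_norm (exprn_ge0 _ (ltW s_gt0))) => h.
by rewrite mulrAC -ler_pdivrMr ?invr_gt0 ?exprn_gt0 // invrK mulrC.
Qed.

End Chebyshev.

(** * Laws of labelings *)

Section Transfer.
Context d d' {W : measurableType d} {T : measurableType d'} {R : realType}
  (P : probability W R) (Q : probability T R) (H : W -> T).
Hypotheses (mH : measurable_fun setT H)
  (law : forall A, measurable A -> P (H @^-1` A) = Q A).

Let ge0_integral_comp (f : T -> \bar R) : measurable_fun setT f ->
  (forall x, 0 <= f x)%E -> (\int[P]_w f (H w) = \int[Q]_x f x)%E.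
Proof.
move=> mf f0; have := @ge0_integral_pushforward _ _ _ _ _ _ mH P setT f measurableT mf.
rewrite preimage_setT => <- //.
by apply: eq_measure_integral => A mA _; exact: law.
Qed.

Lemma Lfun_comp (p : R) f : 1 <= p -> f \in Lfun Q p%:E -> f \o H \in Lfun P p%:E.
Proof.
move=> p1; rewrite !inE => /andP[]; rewrite !inE /= => mf.
rewrite /finite_norm => nf; apply/andP; rewrite !inE /=; split.
  exact: measurableT_comp.
move: nf; rewrite /finite_norm unlock; congr (_ < _)%E; congr (_ `^ _)%E.
rewrite -ge0_integral_comp // => [|x]; last exact: poweR_ge0.
apply: (measurableT_comp (measurable_poweR _)); apply: measurableT_comp => //.
exact/measurable_EFinP.
Qed.

Lemma expectation_comp f : f \in Lfun Q 1 -> ('E_P[f \o H] = 'E_Q[f])%E.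
Proof.
move=> f1; have fH1 := Lfun_comp (lexx _) f1.
have mf : measurable_fun setT (EFin \o f).
  by move: f1; rewrite inE => /andP[]; rewrite !inE /= => mf _; exact/measurable_EFinP.
rewrite unlock; have := @integral_pushforward _ _ _ _ _ _ mH P setT _ mf.
rewrite preimage_setT => <- //; last exact/Lfun1_integrable.
by apply: eq_measure_integral => A mA _; exact: law.
Qed.

Lemma covariance_comp f g : f \in Lfun Q 2%:E -> g \in Lfun Q 2%:E ->
  covariance P (f \o H) (g \o H) = covariance Q f g.
Proof.
move=> f2 g2.
have two : (1 <= 2 :> R) by rewrite ler1n.
have f1 := Lfun_subset12 (fin_num_measure Q _ measurableT) f2.
have g1 := Lfun_subset12 (fin_num_measure Q _ measurableT) g2.
have fg1 := Lfun2_mul_Lfun1 f2 g2.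
rewrite !covarianceE //; last 3 first.
- exact: (Lfun_comp (lexx 1)).
- exact: (Lfun_comp (lexx 1)).
- exact: (Lfun_comp (lexx 1) fg1).
by rewrite !expectation_comp // (expectation_comp fg1).
Qed.

End Transfer.

(** * Product laws of finite families of labels *)

Section LabelingLaw.
Context {dOm : measure_display} {Om : measurableType dOm} {R : realType}
  (mu : probability Om R).

Definition boxes (U : finType) : set (set (labeling U Om)) :=
  [set [set x | forall u, A u (x u)] | A in [set A | forall u, measurable (A u)]].

Lemma measurable_coord (U : finType) (u : U) :
  measurable_fun setT (fun x : labeling U Om => x u).
Proof.
move=> _ A mA; rewrite setTI; apply: sub_sigma_algebra.
by exists u, A.
Qed.

Lemma measurable_labeling d (W : measurableType d) (U : finType) (g : W -> labeling U Om) :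
  (forall u, measurable_fun setT (fun w => g w u)) -> measurable_fun setT g.
Proof.
move=> mg; apply: (@measurability _ _ _ (labeling U Om) setT _ (@cylinders U dOm Om) erefl).
by move=> _ [_ [u [A [mA ->]]] <-]; exact: (mg u measurableT _ mA).
Qed.

Lemma measurable_box (U : finType) (A : U -> set Om) : (forall u, measurable (A u)) ->
  measurable ([set x | forall u, A u (x u)] : set (labeling U Om)).
Proof.
move=> mA; rewrite (_ : [set x | _] = \bigcap_u [set x | A u (x u)]); last first.
  by apply/seteqP; split => x Ax; [move=> u _; exact: Ax | move=> u; exact: Ax].
apply: fin_bigcap_measurable => [|u _]; first exact: finite_finset.
by rewrite -[X in measurable X]setTI; exact: measurable_coord.
Qed.

(** The boxes are stable under intersection and generate the product sigma-algebra, a cylinder being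
    a box whose other sides are full. *)
Lemma labeling_law_unique (U : finType) (m1 m2 : probability (labeling U Om) R) :
  (forall A : U -> set Om, (forall u, measurable (A u)) ->
    m1 [set x | forall u, A u (x u)] = m2 [set x | forall u, A u (x u)]) ->
  forall A, measurable A -> m1 A = m2 A.
Proof.
move=> m12; apply: (measure_unique (@boxes U) (fun=> setT)).
- rewrite eqEsubset; split.
    apply: smallest_sub; first exact: smallest_sigma_algebra.
    move=> _ [u [A [mA ->]]]; apply: sub_sigma_algebra.
    exists (fun v => if v == u then A else setT) => [v /=|]; first by case: ifP.
    apply/seteqP; split=> x /= Ax => [|v]; first by have := Ax u; rewrite eqxx.
    by case: eqP => // ->.
  apply: smallest_sub; first exact: sigma_algebra_measurable.
  by move=> _ [A mA <-]; exact: measurable_box.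
- move=> _ _ [A mA <-] [B mB <-]; exists (fun u => A u `&` B u) => [u /=|].
    exact: measurableI.
  apply/seteqP; split=> x /= ABx; first by split=> u; have [] := ABx u.
  by case: ABx => Ax Bx u; split.
- by move=> _; exists (fun=> setT) => //; apply/seteqP; split.
- by rewrite bigcup_const //; exists 0%N.
- by move=> _ [A mA <-]; exact: m12.
- by move=> _; exact: le_lt_trans (probability_le1 m1 measurableT) (ltry _).
Qed.

Definition subfamily d (W : measurableType d) (P : probability W R) (V : choiceType)
    (h : V -> {RV P >-> Om}) (U : finType) (j : U -> V) (w : W) : labeling U Om :=
  fun u => h (j u) w.

Lemma measurable_subfamily d (W : measurableType d) (P : probability W R)
    (V : choiceType) (h : V -> {RV P >-> Om}) (U : finType) (j : U -> V) :
  measurable_fun setT (subfamily h j).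
Proof. by apply: measurable_labeling => u; exact: measurable_funP. Qed.

HB.instance Definition _ d (W : measurableType d) (P : probability W R)
    (V : choiceType) (h : V -> {RV P >-> Om}) (U : finType) (j : U -> V) :=
  isMeasurableFun.Build _ _ _ _ (subfamily h j) (measurable_subfamily h j).

(** The set [D] allows label families indexed by the whole infinite tree but independent only on a
    finite ball, as in [tree_labels]. *)
Definition product_law_on d (W : measurableType d) (P : probability W R)
    (V : choiceType) (D : set V) (h : V -> {RV P >-> Om}) :=
  forall (U : finType) (j : U -> V), injective j -> (forall u, D (j u)) ->
  forall A, measurable A -> P (subfamily h j @^-1` A) = product_prob mu U A.

Lemma iid_product_law d (W : measurableType d) (P : probability W R)
    (V : choiceType) (h : V -> {RV P >-> Om}) (D : set V) :
  iid_labeling mu h -> product_law_on D h.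
Proof.
move=> [h1 h2] U j j_inj _.
apply: (labeling_law_unique (m1 := distribution P (subfamily h j))) => A mA.
rewrite product_prob_box //.
pose B v := if [pick u | j u == v] is Some u then A u else setT.
have Bj u : B (j u) = A u.
  rewrite /B; case: pickP => [u' /eqP/j_inj -> //|/(_ u)]; by rewrite eqxx.
have mB v : measurable (B v) by rewrite /B; case: pickP.
transitivity (P (\bigcap_(v in [set` map j (enum U)]) (h v @^-1` B v))).
  congr (P _); apply/seteqP; split => w /= Aw.
    by move=> _ /= /mapP[u _ ->] /=; rewrite Bj; exact: Aw.
  move=> u; rewrite -Bj; apply: (Aw (j u)) => /=.
  by apply: map_f; rewrite mem_enum.
have us : uniq (map j (enum U)) by rewrite map_inj_uniq ?enum_uniq.
rewrite h2 // big_map big_enum /=; apply: eq_bigr => u _.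
by rewrite -(h1 (j u)) // Bj.
Qed.

Definition coordinate (U : finType) (u : U) : labeling U Om -> Om := fun x => x u.

HB.instance Definition _ (U : finType) (u : U) :=
  isMeasurableFun.Build _ _ _ _ (@coordinate U u) (@measurable_coord U u).

Definition coordinates (U : finType) (V : choiceType) (i : V -> U) (v : V) :
  {RV (product_prob mu U) >-> Om} := @coordinate U (i v).

Lemma coordinates_iid (U : finType) : iid_labeling mu (@coordinates U U id).
Proof.
have box (s : seq U) (A : U -> set Om) : uniq s -> (forall u, measurable (A u)) ->
    product_prob mu U (\bigcap_(u in [set` s]) (coordinate u @^-1` A u)) =
    (\prod_(u <- s) mu (A u))%E.
  move=> us mA; rewrite big_uniq // big_mkcond /=.
  transitivity (product_prob mu U
      [set x | forall u, (if u \in s then A u else setT) (x u)]).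
    congr (product_prob _ _ _); apply/seteqP; split=> x /= Ax u; last first.
      by move=> /= us'; have := Ax u; rewrite us'.
    by case: ifPn => // us'; exact: Ax.
  rewrite (product_prob_box mu (A := fun u => if u \in s then A u else setT)); last first.
    by move=> u; case: ifP.
  by apply: eq_bigr => u _; case: ifP => // _; exact: probability_setT.
have law u A : measurable A -> product_prob mu U (coordinate u @^-1` A) = mu A.
  move=> mA; have := box [:: u] (fun=> A) isT (fun=> mA).
  rewrite big_seq1 => <-; congr (product_prob _ _ _); apply/seteqP; split=> x /= Ax.
    by move=> v /=; rewrite inE => /eqP ->.
  by apply: (Ax u) => /=; rewrite inE.
split=> // s A us mA; rewrite [LHS]box //.
by apply: eq_bigr => u _; apply/esym/law.
Qed.

Lemma coordinates_product_law (U : finType) (V : choiceType) (i : V -> U) (D : set V) :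
  {in D &, injective i} -> product_law_on D (coordinates i).
Proof.
move=> i_inj S j j_inj jD; apply: (iid_product_law (D := setT) (@coordinates_iid U)
  (j := i \o j)) => // a b /i_inj ab; apply/j_inj/ab; exact/mem_set.
Qed.

End LabelingLaw.

(** The product of two square-integrable functions is integrable, and Fubini factors its
    expectation. *)
Lemma covariance_product d d' (X : measurableType d) (Y : measurableType d')
    (R : realType) (P : probability X R) (Q : probability Y R) (f : X -> R) (g : Y -> R) :
  f \in Lfun P 2%:E -> g \in Lfun Q 2%:E ->
  covariance (P \x Q)%E (f \o fst) (g \o snd) = 0.
Proof.
move=> f2 g2; have two : (1 <= 2 :> R) by rewrite ler1n.
have law1 A : measurable A -> (P \x Q)%E (fst @^-1` A) = P A.
  move=> mA; rewrite (_ : fst @^-1` A = A `*` setT); last first.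
    by apply/seteqP; split=> -[x y] //= -[].
  by rewrite product_measure1E // -[RHS]mule1; congr (_ * _)%E; exact: probability_setT.
have law2 A : measurable A -> (P \x Q)%E (snd @^-1` A) = Q A.
  move=> mA; rewrite (_ : snd @^-1` A = setT `*` A); last first.
    by apply/seteqP; split=> -[x y] //= -[].
  by rewrite product_measure1E // -[RHS]mul1e; congr (_ * _)%E; exact: probability_setT.
have f1 := Lfun_subset12 (fin_num_measure P _ measurableT) f2.
have g1 := Lfun_subset12 (fin_num_measure Q _ measurableT) g2.
have F2 := Lfun_comp (P := (P \x Q)%E) measurable_fst law1 two f2.
have G2 := Lfun_comp (P := (P \x Q)%E) measurable_snd law2 two g2.
have FG1 := Lfun2_mul_Lfun1 F2 G2.
rewrite covarianceE //; last 2 first.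
- exact: (Lfun_comp (P := (P \x Q)%E) measurable_fst law1 (lexx 1) f1).
- exact: (Lfun_comp (P := (P \x Q)%E) measurable_snd law2 (lexx 1) g1).
rewrite (expectation_comp (P := (P \x Q)%E) measurable_fst law1 f1).
rewrite (expectation_comp (P := (P \x Q)%E) measurable_snd law2 g1).
have -> : expectation (P \x Q)%E ((f \o fst) * (g \o snd))%R = ('E_P[f] * 'E_Q[g])%E.
  have iFG : (P \x Q)%E.-integrable setT (EFin \o ((f \o fst) * (g \o snd))%R).
    exact/Lfun1_integrable.
  transitivity (\int[(P \x Q)%E]_z (EFin \o ((f \o fst) * (g \o snd))%R) z)%E.
    by rewrite unlock.
  rewrite -(integral12_prod_meas1 iFG) /fubini_F.
  transitivity (\int[P]_x ((f x)%:E * 'E_Q[g]))%E.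
    apply: eq_integral => x _; rewrite unlock -integralZl //.
    exact/Lfun1_integrable.
  rewrite -(fineK (expectation_fin_num g1)) integralZr //; last exact/Lfun1_integrable.
  by congr (_ * _)%E; rewrite unlock.
by rewrite subee // fin_numM ?expectation_fin_num.
Qed.

Section Independence.
Context {dOm : measure_display} {Om : measurableType dOm} {R : realType}
  (mu : probability Om R).

Definition relabel (S U : finType) (alpha : S -> U) (x : labeling U Om) :
  labeling S Om := x \o alpha.

Lemma measurable_relabel (S U : finType) (alpha : S -> U) :
  measurable_fun setT (relabel alpha).
Proof. by apply: measurable_labeling => s; exact: measurable_coord. Qed.

Lemma relabel_law (S U : finType) (alpha : S -> U) A : injective alpha ->
  measurable A -> product_prob mu U (relabel alpha @^-1` A) = product_prob mu S A.
Proof.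
move=> inj; have id_inj : {in [set: U] &, injective id} by [].
exact: (coordinates_product_law mu id_inj inj (fun=> I)).
Qed.

Definition glue (S S' : finType) (x : labeling S Om * labeling S' Om) :
  labeling (S + S')%type Om :=
  fun s => match s with inl a => x.1 a | inr b => x.2 b end.

Lemma measurable_glue (S S' : finType) : measurable_fun setT (@glue S S').
Proof.
apply: measurable_labeling => -[s|s].
  exact: (measurableT_comp (measurable_coord s) measurable_fst).
exact: (measurableT_comp (measurable_coord s) measurable_snd).
Qed.

HB.instance Definition _ (S S' : finType) :=
  isMeasurableFun.Build _ _ _ _ (@glue S S') (@measurable_glue S S').

Lemma glue_law (S S' : finType) A : measurable A ->
  (product_prob mu S \x product_prob mu S')%E (@glue S S' @^-1` A) =
  product_prob mu (S + S')%type A.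
Proof.
move: A; apply: (labeling_law_unique
  (m1 := distribution (product_prob mu S \x product_prob mu S')%E (@glue S S'))) => A mA.
rewrite product_prob_box // big_sumType /=.
have mbox (T : finType) (g : T -> S + S') := measurable_box (fun t => mA (g t)).
have boxE (T : finType) (g : T -> S + S') := product_prob_box mu (fun t => mA (g t)).
rewrite -(boxE _ inl) -(boxE _ inr) -product_measure1E; [|exact: mbox|exact: mbox].
congr (_ _); apply/seteqP; split=> -[x y] /= Axy.
  by split=> s; [exact: (Axy (inl s))|exact: (Axy (inr s))].
by case: Axy => Ax Ay [s|s]; [exact: Ax|exact: Ay].
Qed.

(** Having disjoint images, [alpha] and [beta] combine into one injection of the sum type [S + S],
    whose product law is the product of two copies of the law on [S]. *)
Lemma covariance_disjoint (S U : finType) (alpha beta : S -> U)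
    (f : labeling S Om -> R) :
  f \in Lfun (product_prob mu S) 2%:E -> injective alpha -> injective beta ->
  (forall s t, alpha s != beta t) ->
  covariance (product_prob mu U) (f \o relabel alpha) (f \o relabel beta) = 0.
Proof.
move=> f2 ai bi ab; set Q := product_prob mu S.
pose gamma s := match s with inl a => alpha a | inr b => beta b end.
have gi : injective gamma.
  move=> [a|a] [b|b] //=; try by move=> /ai -> || move=> /bi ->.
    by move=> E; have := ab a b; rewrite E eqxx.
  by move=> E; have := ab b a; rewrite E eqxx.
have gl A : measurable A -> _ := @relabel_law _ _ gamma A gi.
have li : injective (@inl S S) by move=> a b [].
have ri : injective (@inr S S) by move=> a b [].
have two : (1 <= 2 :> R) by rewrite ler1n.
have fl : f \o relabel (@inl S S) \in Lfun (product_prob mu (S + S)%type) 2%:E.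
  exact: (Lfun_comp (measurable_relabel _) (fun A => @relabel_law _ _ _ A li)).
have fr : f \o relabel (@inr S S) \in Lfun (product_prob mu (S + S)%type) 2%:E.
  exact: (Lfun_comp (measurable_relabel _) (fun A => @relabel_law _ _ _ A ri)).
have -> : f \o relabel alpha = (f \o relabel inl) \o relabel gamma by [].
have -> : f \o relabel beta = (f \o relabel inr) \o relabel gamma by [].
rewrite (covariance_comp (measurable_relabel _) gl fl fr).
rewrite -(covariance_comp (@measurable_glue S S) (@glue_law S S) fl fr).
have -> : (f \o relabel inl) \o @glue S S = f \o fst by [].
have -> : (f \o relabel inr) \o @glue S S = f \o snd by [].
exact: covariance_product.
Qed.

End Independence.

(** * Covers of the tree by itself *)

Section TreeCover.
Context {d : nat}.
Implicit Types w : seq 'I_d.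

Definition tree_word w : tree d := insubd tree_root w.

Lemma val_tree_word w : reduced w -> val (tree_word w) = w.
Proof. by move=> rw; rewrite val_insubd rw. Qed.

Lemma tree_word_cover : cover (@tree_edge d) tree_word.
Proof.
move=> w rw; split=> [a b /(congr1 val)|].
  by rewrite !val_tree_word ?step_reduced // => /step_inj.
apply/seteqP; split=> [_ [a _ <-]|[u ru]] /=.
  rewrite /tree_edge /= !val_tree_word ?step_reduced //.
  by apply/word_edgeP; rewrite ?step_reduced //; exists a.
rewrite /tree_edge /= val_tree_word // => /(word_edgeP rw ru)[a E]; exists a => //.
by apply: val_inj; rewrite val_tree_word ?step_reduced.
Qed.

Lemma size_cover_tree (Phi : seq 'I_d -> tree d) w : cover (@tree_edge d) Phi ->
  Phi [::] = tree_root -> reduced w -> (size (val (Phi w)) <= size w)%N.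
Proof.
move=> cPhi Phi0; elim: w => [|a w IHw] rw; first by rewrite Phi0.
have rw' : reduced w := path_sorted rw.
have := cover_edge cPhi a rw'; rewrite step_cons // => /tree_edge_size.
by case=> [E|->]; [have := IHw rw'; rewrite E /=; lia|exact: IHw].
Qed.

(** Such a self-cover stands in for an automorphism of the tree that fixes the root and moves [z] to
    [z']. It is built along the walk from [z'] to the root. *)
Lemma cover_exists_tree (z z' : seq 'I_d) : reduced z -> reduced z' -> size z = size z' ->
  exists Phi, [/\ cover (@tree_edge d) Phi, Phi [::] = tree_root &
    Phi z = tree_word z'].
Proof.
move=> rz rz' zz'; have r0 : reduced ([::] : seq 'I_d) by [].
have tE l w : exists q, [/\ size q = size l, trail l w = rcons q w & head w q = act l w].
  elim: l => [|a l [q [sq tq _]]]; first by exists [::].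
  by exists (act (a :: l) w :: q); rewrite /= sq tq.
have [q [sq tq hq]] := tE z' [::].
have sw := trail_sorted (@tree_edge_sym d) tree_word_cover z' r0.
have nw := trail_nobt tree_word_cover r0 rz'.
have t0 : tree_word [::] = tree_root by apply: val_inj; rewrite val_tree_word.
have [|||Phi [cPhi Phi0 Phiz]] := cover_exists (@tree_edge_sym d) (@tree_regular d)
    (v := tree_root) (q := map tree_word q) rz.
- by rewrite size_map sq.
- by rewrite -t0 -map_rcons -tq.
- by rewrite -t0 -map_rcons -tq.
exists Phi; split=> //; rewrite Phiz -t0.
have := congr1 tree_word hq; rewrite act_nil // => <-.
by case: (q).
Qed.

(** Vertices farther than [N] from the root are sent to the root, so injectivity holds only within
    the ball. *)
Definition tball_word N (x : tree d) : tball d N :=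
  insubd tball_root (insub_bseq N (val x)).

Lemma val_tball_word N (x : tree d) : (size (val x) <= N)%N ->
  val (val (tball_word N x)) = val x.
Proof.
move=> xN; have E : val (insub_bseq N (val x)) = val x by rewrite val_insubd xN.
by rewrite val_insubd E (valP x).
Qed.

Lemma tball_word_inj N :
  {in [set x : tree d | (size (val x) <= N)%N] &, injective (@tball_word N)}.
Proof.
move=> x y; rewrite !inE /= => xN yN /(congr1 (fun u => val (val u))).
by rewrite !val_tball_word // => /val_inj.
Qed.

End TreeCover.

(** * Covariance of the outputs *)

Section RuleCovariance.
Context {d r : nat} {dOm : measure_display} {Om : measurableType dOm} {R : realType}
  (mu : probability Om R).
Variable f : labeling (tball d r) Om -> R.
Hypotheses (f_L2 : f \in Lfun (product_prob mu (tball d r)) 2%:E)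
  (f_inv : rule_invariant f).
Implicit Types z w : seq 'I_d.

(* Since a cover of a graph of large girth is injective on the union of the balls
   around the root and [z], the covariance of the outputs at their images depends
   only on how these two balls overlap in the tree. *)
Definition two_balls z : seq (seq 'I_d) :=
  codom (fun s : tball d r => val (val s)) ++
  codom (fun s : tball d r => act (val (val s)) z).

Lemma root_ball_mem z (s : tball d r) : val (val s) \in two_balls z.
Proof. by rewrite mem_cat; apply/orP; left; apply/codomP; exists s. Qed.

Lemma other_ball_mem z (s : tball d r) : act (val (val s)) z \in two_balls z.
Proof. by rewrite mem_cat; apply/orP; right; apply/codomP; exists s. Qed.

Definition root_ball z (s : tball d r) : seq_sub (two_balls z) :=
  SeqSub (root_ball_mem z s).

Definition other_ball z (s : tball d r) : seq_sub (two_balls z) :=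
  SeqSub (other_ball_mem z s).

Lemma root_ball_inj z : injective (root_ball z).
Proof. by move=> s t /(congr1 val) /= /val_inj/val_inj. Qed.

Lemma act_inj z : reduced z ->
  {in [pred w | reduced w] &, injective (act ^~ z)}.
Proof.
move=> rz s t rs rt E.
have K w : reduced w -> w = word_div (act w z) z.
  by move=> rw; rewrite /word_div act_act ?rev_reduced // -{1}[z]revK
    act_rev_self ?rev_reduced // act_nil.
by rewrite [s]K // [t]K // E.
Qed.

Lemma other_ball_inj z : reduced z -> injective (other_ball z).
Proof.
move=> rz s t /(congr1 val) /= E; apply: val_inj; apply: val_inj.
exact: (act_inj rz (valP s) (valP t) E).
Qed.

Definition kernel z : R := fine (covariance (product_prob mu (seq_sub (two_balls z)))
  (f \o relabel (root_ball z)) (f \o relabel (other_ball z))).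

(** A common point would put [z] within [2 * r] of the root, so the two balls are disjoint and carry
    independent labels. *)
Lemma kernel_eq0 z : reduced z -> (2 * r < size z)%N -> kernel z = 0.
Proof.
move=> rz rsz; rewrite /kernel covariance_disjoint //.
- exact: root_ball_inj.
- exact: other_ball_inj.
move=> s t; apply/eqP => /(congr1 val) /= E.
have sz : (size (act (val (val t)) z) <= r)%N by rewrite -E; exact: size_bseq (val s).
have := leq_trans (size_act_ge _ _) (leq_add (size_bseq (val t)) sz).
by move: rsz; lia.
Qed.

Section Realization.
Context {V : choiceType} (e : rel V) {dW : measure_display} {W : measurableType dW}
  (P : probability W R) (h : V -> {RV P >-> Om}) (D : set V).
Hypotheses (e_sym : symmetric e) (e_irr : irreflexive e) (h_law : product_law_on mu D h).
Variables (Phi : seq 'I_d -> V) (z : seq 'I_d).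
Hypotheses (cPhi : cover e Phi) (rz : reduced z)
  (e_girth : girth_at_least e (size z + 2 * r + 2)).
Hypotheses (D_root : forall s : tball d r, D (Phi (val (val s))))
  (D_other : forall s : tball d r, D (Phi (act (val (val s)) z))).

Let j (u : seq_sub (two_balls z)) := Phi (val u).

Let j_inj : injective j.
Proof.
have ball_reduced (s : tball d r) : reduced (val (val s)) := valP s.
have ball_size (s : tball d r) : (size (val (val s)) <= r)%N := size_bseq (val s).
have inv (s : tball d r) x : reduced x ->
    act (rev (val (val s))) (act (val (val s)) x) = x by exact: act_revK.
(* Two points of the union differ by a word of length at most [size z + 2 * r], below the girth, so
   the cover separates them. *)
have two_balls_close x y : x \in two_balls z -> y \in two_balls z ->
    exists2 l, (size l < size z + 2 * r + 2)%N & y = act l x.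
  rewrite !mem_cat => /orP[] /codomP[s ->] /orP[] /codomP[t ->].
  - exists (val (val t) ++ rev (val (val s))).
      rewrite size_cat size_rev.
      by apply: leq_ltn_trans (leq_add (ball_size t) (ball_size s)) _; lia.
    by rewrite act_cat act_rev_self // act_nil.
  - exists (val (val t) ++ z ++ rev (val (val s))).
      rewrite !size_cat size_rev.
      apply: leq_ltn_trans (leq_add (ball_size t) (leq_add (leqnn _) (ball_size s))) _.
      by lia.
    by rewrite !act_cat act_rev_self // (act_nil rz).
  - exists (val (val t) ++ rev z ++ rev (val (val s))).
      rewrite !size_cat !size_rev.
      apply: leq_ltn_trans (leq_add (ball_size t) (leq_add (leqnn _) (ball_size s))) _.
      by lia.
    by rewrite !act_cat inv // act_rev_self // act_nil.
  - exists (val (val t) ++ rev (val (val s))).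
      rewrite size_cat size_rev.
      by apply: leq_ltn_trans (leq_add (ball_size t) (ball_size s)) _; lia.
    by rewrite act_cat inv.
have two_balls_reduced x : x \in two_balls z -> reduced x.
  by rewrite mem_cat => /orP[] /codomP[s ->] //; exact: act_reduced.
move=> u u' E; apply: val_inj.
have [l lg lE] := two_balls_close _ _ (valP u') (valP u).
rewrite lE; apply: (cover_inj e_sym e_irr cPhi e_girth) => //.
  exact/two_balls_reduced/valP.
by rewrite -lE.
Qed.

Let jD u : D (j u).
Proof.
rewrite /j; have := valP u; rewrite mem_cat => /orP[] /codomP[s ->].
  exact: D_root.
exact: D_other.
Qed.

Let root_output : local_output e f h (Phi [::]) =
  (f \o relabel (root_ball z)) \o subfamily h j.
Proof.
rewrite (local_outputE h f_inv (cover_rooted_iso e_sym e_irr cPhi e_girth _)) //.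
by lia.
Qed.

Let other_output : local_output e f h (Phi z) =
  (f \o relabel (other_ball z)) \o subfamily h j.
Proof.
have := cover_rooted_iso e_sym e_irr (cover_translate rz cPhi) e_girth (r := r).
move=> /(_ _)/(local_outputE h f_inv) -> //.
by lia.
Qed.

Let j_law A : measurable A ->
  P (subfamily h j @^-1` A) = product_prob mu (seq_sub (two_balls z)) A.
Proof. exact: h_law. Qed.

Let two : (1 <= 2 :> R). Proof. by rewrite ler1n. Qed.

Let root_L2 : f \o relabel (root_ball z) \in
  Lfun (product_prob mu (seq_sub (two_balls z))) 2%:E.
Proof.
have law A := @relabel_law _ _ _ mu _ _ (root_ball z) A (@root_ball_inj z).
exact: (Lfun_comp (measurable_relabel _) law two f_L2).
Qed.

Let other_L2 : f \o relabel (other_ball z) \in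
  Lfun (product_prob mu (seq_sub (two_balls z))) 2%:E.
Proof.
have law A := @relabel_law _ _ _ mu _ _ (other_ball z) A (other_ball_inj rz).
exact: (Lfun_comp (measurable_relabel _) law two f_L2).
Qed.

(** Both outputs are functions of the labels along the injective family [j], which have the product
    law. The ball around [Phi z] is charted by the cover translated by [z]. *)
Lemma cover_output_covariance :
  covariance P (local_output e f h (Phi [::])) (local_output e f h (Phi z)) =
  covariance (product_prob mu (seq_sub (two_balls z)))
    (f \o relabel (root_ball z)) (f \o relabel (other_ball z)).
Proof.
rewrite root_output other_output.
exact: (covariance_comp (measurable_subfamily h j) j_law root_L2 other_L2).
Qed.

Lemma cover_output_Lfun : local_output e f h (Phi [::]) \in Lfun P 2%:E.
Proof.
rewrite root_output.
exact: (Lfun_comp (measurable_subfamily h j) j_law two root_L2).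
Qed.

End Realization.

(** * The rule run on a finite ball of the tree *)

Definition tree_labels N : tree d -> {RV (product_prob mu (tball d N)) >-> Om} :=
  coordinates mu (@tball_word d N).
Arguments tree_labels : clear implicits.

Definition tree_output N (x : seq 'I_d) : labeling (tball d N) Om -> R :=
  local_output (@tree_edge d) f (tree_labels N) (tree_word x).
Arguments tree_output : clear implicits.

Lemma tree_labels_law N :
  product_law_on mu [set x : tree d | (size (val x) <= N)%N] (tree_labels N).
Proof. exact: coordinates_product_law (@tball_word_inj d N). Qed.

Lemma cover_tree_covariance N (Phi : seq 'I_d -> tree d) z :
  cover (@tree_edge d) Phi -> reduced z ->
  (forall w, reduced w -> (size (val (Phi w)) <= size w + size (val (Phi [::])))%N) ->
  (forall w, reduced w -> (size (val (Phi (act w z))) <= size w + size (val (Phi z)))%N) ->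
  (size (val (Phi [::])) + r <= N)%N -> (size (val (Phi z)) + r <= N)%N ->
  fine (covariance (product_prob mu (tball d N))
    (local_output (@tree_edge d) f (tree_labels N) (Phi [::]))
    (local_output (@tree_edge d) f (tree_labels N) (Phi z))) = kernel z.
Proof.
move=> cPhi rz size_root size_other N0 Nz.
have ball (s : tball d r) : (size (val (val s)) <= r)%N := size_bseq (val s).
rewrite (cover_output_covariance (@tree_edge_sym d) (@tree_edge_irr d)
  (@tree_labels_law N) cPhi rz (@tree_acyclic d _)) // => s /=.
- apply: leq_trans (size_root _ (valP s)) _.
  by apply: leq_trans N0; rewrite addnC leq_add2l ball.
- apply: leq_trans (size_other _ (valP s)) _.
  by apply: leq_trans Nz; rewrite addnC leq_add2l ball.
Qed.

Lemma tree_word_translate_cover x : reduced x ->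
  cover (@tree_edge d) (fun w => tree_word (act w x)).
Proof. by move=> rx; apply: cover_translate => //; exact: tree_word_cover. Qed.

Lemma size_tree_word_act w x : reduced x ->
  (size (val (tree_word (act w x))) <= size w + size x)%N.
Proof. by move=> rx; rewrite val_tree_word ?act_reduced // size_act. Qed.

(** Translation by [x] gives a cover based at [x], in which [y] is the image of [word_div y x]. *)
Lemma tree_output_covariance N x y : reduced x -> reduced y ->
  (size x + r <= N)%N -> (size y + r <= N)%N ->
  fine (covariance (product_prob mu (tball d N)) (tree_output N x) (tree_output N y)) =
  kernel (word_div y x).
Proof.
move=> rx ry xN yN; have rz := word_div_reduced y rx.
have := cover_tree_covariance (N := N) (tree_word_translate_cover rx) rz.
rewrite /= act_word_div // !val_tree_word //; apply=> // w rw.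
  exact: size_tree_word_act.
by rewrite act_act // act_word_div //; exact: size_tree_word_act.
Qed.

(** The covariance of the tree outputs at the root and at [z'] is computed twice: through a
    self-cover taking [z] to [z'], and through the identity cover. *)
Lemma kernel_radial z z' : reduced z -> reduced z' -> size z = size z' ->
  kernel z = kernel z'.
Proof.
move=> rz rz' zz'; have [Phi [cPhi Phi0 Phiz]] := cover_exists_tree rz rz' zz'.
have sPhi w (rw : reduced w) := size_cover_tree cPhi Phi0 rw.
have := cover_tree_covariance (N := size z' + r) cPhi rz.
rewrite Phi0 Phiz val_tree_word // => <- //.
- have := tree_output_covariance (N := size z' + r) (x := [::]) (y := z') isT rz'.
  rewrite word_div_nil // leq_addl leqnn => /(_ isT isT) <-; congr (fine (covariance _ _ _)).
  congr (local_output _ _ _ _); apply: val_inj.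
  by rewrite val_tree_word.
- by move=> w rw; rewrite addn0 sPhi.
- move=> w rw; elim: w rw => [|a w IHw] rw; first by rewrite /= Phiz val_tree_word.
  have rw' : reduced w := path_sorted rw.
  have := cover_edge cPhi a (act_reduced w rz) => /tree_edge_size.
  by have := IHw rw'; rewrite /= => IH [] E; lia.
- exact: leq_addl.
Qed.

Lemma tree_output_Lfun N x : reduced x -> (size x + r <= N)%N ->
  tree_output N x \in Lfun (product_prob mu (tball d N)) 2%:E.
Proof.
move=> rx xN; have r0 : reduced ([::] : seq 'I_d) by [].
have ball (s : tball d r) : (size (val (val s)) <= r)%N := size_bseq (val s).
have DN (s : tball d r) :
    [set x : tree d | (size (val x) <= N)%N] (tree_word (act (val (val s)) x)).
  rewrite /=; apply: leq_trans (size_tree_word_act _ rx) _.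
  by apply: leq_trans xN; rewrite addnC leq_add2l ball.
apply: (cover_output_Lfun (@tree_edge_sym d) (@tree_edge_irr d)
  (@tree_labels_law N) (tree_word_translate_cover rx) r0 (@tree_acyclic d _)) => s.
  exact: DN.
by rewrite (act_nil (valP s)); exact: DN.
Qed.

End RuleCovariance.

Arguments tree_output {d r dOm Om R} mu f N x.

Lemma sorted_alternating (d : nat) (a b : 'I_d) n : a != b ->
  exists2 z : seq 'I_d, reduced z & size z = n.
Proof.
move=> ab; exists (mkseq (fun i => if odd i then a else b) n); last exact: size_mkseq.
apply/(sortedP a) => i; rewrite size_mkseq => ni.
by rewrite !nth_mkseq ?(ltnW ni) //=; case: (odd i) => /=; rewrite // eq_sym.
Qed.

(** * Decay of the covariance kernel *)

Section KernelDecay.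
Context {d r : nat} {dOm : measure_display} {Om : measurableType dOm} {R : realType}
  (mu : probability Om R).
Variables (f : labeling (tball d r) Om -> R) (c : nat -> R).
Hypotheses (hd : (2 <= d)%N)
  (f_L2 : f \in Lfun (product_prob mu (tball d r)) 2%:E) (f_inv : rule_invariant f)
  (c_kernel : forall z, reduced z -> kernel mu f z = c (size z)).

Lemma kernel_doubling t :
  radial_chebyshev d c t 0%N ^+ 2 <=
    c 0%N * ((radial_chebyshev d c t.*2 0%N + c 0%N) / 2).
Proof.
pose Q := product_prob mu (tball d (t + r)).
have two : (1 <= 2%:E :> \bar R)%E by rewrite lee_fin ler1n.
(* The outputs at words of length at most [t] read labels up to distance [t + r]. The value 0
   elsewhere makes the family total with values in the space of square-integrable functions. *)
pose Y (w : seq 'I_d) : labeling (tball d (t + r)) Om -> R :=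
  if reduced w && (size w <= t)%N then tree_output mu f (t + r)%N w else cst 0.
have YL w : Y w \in Lfun Q 2%:E.
  rewrite /Y; case: ifPn => [/andP[rw wt]|_]; last exact: Lfun_cst.
  by rewrite tree_output_Lfun // leq_add2r.
pose X w : LfunType Q two := Lfun_Sub two (YL w).
pose B (u v : LfunType Q two) : R := fine (covariance Q u v).
have L1 (u : LfunType Q two) : (u : _ -> R) \in Lfun Q 1.
  exact: (Lfun_subset12 (fin_num_measure Q _ measurableT) (LfunP u)).
have LM (u v : LfunType Q two) : ((u : _ -> R) * v)%R \in Lfun Q 1.
  exact: (Lfun2_mul_Lfun1 (LfunP u) (LfunP v)).
have covf (u v : LfunType Q two) : covariance Q u v \is a fin_num.
  exact: covariance_fin_num.
apply: (@radial_chebyshev_doubling R d hd (LfunType Q two) B _ _ _ _ t X c) => //.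
- move=> a u v; rewrite /B.
  have -> : (a *: u : LfunType Q two) = a \o* u :> (_ -> R).
    by apply/funext => x; rewrite /= mulrC.
  by rewrite covarianceZl // fineM.
- move=> u v w; rewrite /B.
  have -> : (u + v : LfunType Q two) = u \+ v :> (_ -> R) by [].
  by rewrite covarianceDl ?LfunP // fineD.
- by move=> u v; rewrite /B covarianceC.
- by move=> u; rewrite /B fine_ge0 // variance_ge0.
- move=> x y rx ry xt yt; rewrite /B !Lfun_valP /Y rx ry xt yt /=.
  rewrite tree_output_covariance ?leq_add2r // c_kernel //.
  exact: word_div_reduced.
Qed.

Lemma kernel_decay k : `|c k| <=
  (1 + k%:R * (d.-1%:R - 1) / (d.-1%:R + 1)) * Num.sqrt d.-1%:R ^- k * c 0%N.
Proof.
have [a [b ab]] : exists a b : 'I_d, a != b.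
  by exists (Ordinal (ltnW hd)), (Ordinal hd).
apply: (radial_chebyshev_bound hd (m := 2 * r)) => [n rn||]; last exact: kernel_doubling.
  by have [z rz zn] := sorted_alternating n ab; rewrite -zn -c_kernel // kernel_eq0 // zn.
rewrite -(c_kernel (z := [::])) //.
have -> : kernel mu f [::] = fine (covariance (product_prob mu (tball d r))
    (tree_output mu f r [::]) (tree_output mu f r [::])).
  by rewrite (tree_output_covariance f_L2).
by rewrite fine_ge0 // variance_ge0.
Qed.

End KernelDecay.

Theorem theorem4p1 (R : realType) (d r k : nat) (hd : (2 <= d)%N)
  (dOm : measure_display) (Om : measurableType dOm) (mu : probability Om R)
  (f : labeling (tball d r) Om -> R)
  (f_L2 : f \in Lfun (product_prob mu (tball d r)) 2%:E)
  (f_inv : rule_invariant f)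
  (f_nconst : ~ exists c : R, {ae product_prob mu (tball d r), forall x, f x = c})
  (V : choiceType) (e : rel V) (e_sym : symmetric e) (e_irr : irreflexive e)
  (e_reg : regular e d) (e_girth : girth_at_least e (k + 2 * r + 2))
  (dW : measure_display) (W : measurableType dW) (P : probability W R)
  (h : V -> {RV P >-> Om}) (h_iid : iid_labeling mu h)
  (v w : V) (vw : at_distance e v w k) :
  `|correlation P (local_output e f h v) (local_output e f h w)|
    <= (k%:R + 1 - 2 * k%:R / d%:R) * (d%:R - 1) `^ (- (k%:R / 2)).
Proof.
have [a [b ab]] : exists a b : 'I_d, a != b.
  by exists (Ordinal (ltnW hd)), (Ordinal hd).
have /choice[alt altP] : forall n, exists z : seq 'I_d, reduced z /\ size z = n.
  by move=> n; have [z rz zn] := sorted_alternating n ab; exists z.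
(* By radiality any reduced word of length [n] may represent distance [n]; one exists for every [n]
   because [d >= 2] provides two letters to alternate. *)
pose c n := kernel mu f (alt n).
have c_kernel z : reduced z -> kernel mu f z = c (size z).
  by move=> rz; have [ra za] := altP (size z); apply: kernel_radial.
have [rz zk] := altP k; set z := alt k in rz zk.
have [q [qk eq nq qw]] := at_distance_walk e_sym vw.
have [|Phi [cPhi Phi0 Phiz]] := cover_exists e_sym e_reg rz _ eq nq; first by rewrite zk.
rewrite qw in Phiz.
have law := iid_product_law (D := setT) h_iid.
(* A variance is the covariance for the empty word, and the girth bound at distance [k] implies the
   one at distance 0. *)
have variance_output (Phi' : seq 'I_d -> V) : cover e Phi' ->
    fine 'V_P[local_output e f h (Phi' [::])] = c 0%N.
  move=> cPhi'; have [r0 s0] := altP 0%N; have E := size0nil s0.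
  have g0 : girth_at_least e (size (alt 0%N) + 2 * r + 2).
    by move=> C CC C3; apply: leq_trans _ (e_girth C CC C3); rewrite s0; lia.
  rewrite /c /kernel -(cover_output_covariance f_L2 f_inv e_sym e_irr law cPhi' r0 g0) //.
  by rewrite E.
have vv : fine 'V_P[local_output e f h v] = c 0%N by rewrite -Phi0 variance_output.
have vw' : fine 'V_P[local_output e f h w] = c 0%N.
  by rewrite -Phiz; exact: (variance_output _ (cover_translate rz cPhi)).
have cvw : fine (covariance P (local_output e f h v) (local_output e f h w)) = c k.
  rewrite -zk in e_girth.
  by rewrite /c /kernel -(cover_output_covariance f_L2 f_inv e_sym e_irr law cPhi rz e_girth)
    // Phi0 Phiz.
rewrite /correlation vv vw' cvw.
have c0 : 0 <= c 0%N by rewrite -vv fine_ge0 // variance_ge0.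
have := kernel_decay hd f_L2 f_inv c_kernel k.
set A := 1 + _; set S := _ ^- k => ck.
have dE : d.-1%:R = d%:R - 1 :> R by rewrite -subn1 natrB // ltnW.
have d0 : 0 < d%:R - 1 :> R by rewrite -dE ltr0n; lia.
have SE : (d%:R - 1) `^ (- (k%:R / 2)) = S.
  rewrite /S dE powRN mulrC powRrM powR_mulrn ?powR_ge0 //.
  by rewrite powR12_sqrt // ltW.
(* With [q = d - 1], the weight is [1 + k (q - 1) / (q + 1) = 1 + k (d - 2) / d]. *)
have AE : k%:R + 1 - 2 * k%:R / d%:R = A.
  rewrite /A dE subrK; field; rewrite pnatr_eq0; lia.
rewrite SE AE.
have S0 : 0 <= S by rewrite -SE powR_ge0.
have A0 : 0 <= A.
  have q1 : 1 <= d.-1%:R :> R by rewrite ler1n; lia.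
  by rewrite /A addr_ge0 // divr_ge0 // ?addr_ge0 // mulr_ge0 // subr_ge0.
(* If the variance is zero, the quotient is 0 by the convention on division by zero. *)
have [c00|c00] := eqVneq (c 0%N) 0.
  by rewrite c00 sqrtr0 mulr0 invr0 mulr0 normr0 mulr_ge0.
have {}c0 : 0 < c 0%N by rewrite lt_neqAle eq_sym c00.
by rewrite -expr2 sqr_sqrtr ?(ltW c0) // normrM normfV (gtr0_norm c0) ler_pdivrMr.
Qed.
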